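(* Let $G=\mathrm{Dic}_\infty\subset SU(2)$ be the infinite dicyclic group with natural representation $V=\mathbb{C}^2$, let $\mathcal{C}$ be the full monoidal subcategory, monoidally generated by $V$, of the category $\mathbf{Rep}(\mathrm{Dic}_\infty)$ of finite dimensional complex representations of $G$, and let $\mathbf{DiTL}(-2,\infty)$ be the dicyclic Temperley--Lieb category. Let $\mathcal{F}\colon \mathbf{DiTL}(-2,\infty)\to\mathcal{C}$ be the ribbon $\mathbb{C}$-linear functor determined by $\bullet\mapsto V$ and by sending the cap, cup and decorated cup-cap morphisms to $\mathrm{ev}$, $\mathrm{coev}$ and $e_{\bar 1}$, respectively. Then $\mathcal{F}$ is fully faithful.
   Context: **Group.** $\mathrm{Dic}_\infty$ is the subgroup of $SU(2)$ generated by $x=\begin{pmatrix}0&-1\\1&0\end{pmatrix}$ and $a=\mathrm{diag}(e^{i\theta},e^{-i\theta})$, where $\theta$ is an irrational multiple of $\pi$. It acts on $V=\mathbb{C}^2$ with standard basis $v_1,v_2$. **Maps on representations.** $\mathrm{ev}\colon V\otimes V\to\mathbb{C}$ is given by $v_1\otimes v_1,v_2\otimes v_2\mapsto 0$, $v_1\otimes v_2\mapsto 1$, $v_2\otimes v_1\mapsto -1$; $\mathrm{coev}\colon\mathbb{C}\to V\otimes V$ by $1\mapsto v_2\otimes v_1-v_1\otimes v_2$; and $e_{\bar 1}\in\mathrm{End}_G(V^{\otimes 2})$ kills $v_1\otimes v_1$ and $v_2\otimes v_2$ and sends both $v_1\otimes v_2$ and $v_2\otimes v_1$ to $-(v_1\otimes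 v_2+v_2\otimes v_1)$. **Temperley--Lieb category.** $\mathbf{TL}(\delta)$ (here $\delta=-2$) is the free $\mathbb{C}$-linear pivotal category generated by a single (self-dual) object $\bullet$ of categorical dimension $\delta$; its pivotal structure gives the cap $\mathrm{ev}\colon\bullet^{\otimes 2}\to\mathbb{1}$ and the cup $\mathrm{coev}\colon\mathbb{1}\to\bullet^{\otimes 2}$, with relations (1) $\mathrm{ev}\circ\mathrm{coev}=\delta\cdot\mathrm{id}$ and (2) $(\mathrm{ev}\otimes\mathrm{id})\circ(\mathrm{id}\otimes\mathrm{coev})=\mathrm{id}=(\mathrm{id}\otimes\mathrm{ev})\circ(\mathrm{coev}\otimes\mathrm{id})$. **Dicyclic Temperley--Lieb category.** $\mathbf{DiTL}(\delta,\infty)$ (here $\delta=-2$) is the free $\mathbb{C}$-linear (right) $\mathbf{TL}(\delta)$-module category generated by a morphism $e_{\bar 1}\in\mathrm{End}(\bullet^{\otimes 2})$, the decorated cup-cap, subject to (3) $(\mathrm{id}\otimes\mathrm{ev})\circ(e_{\bar 1}\otimes\mathrm{id})\circ(\mathrm{id}\otimes\mathrm{coev})=\mathrm{id}$; (4) $(\mathrm{ev}\otimes\mathrm{id})\circ(\mathrm{id}\otimes e_{\bar 1})\circ(\mathrm{coev}\otimes\mathrm{id})=\mathrm{id}$; (5) $e_{\bar 1}\circ\mathrm{coev}=0=\mathrm{ev}\circ e_{\bar 1}$; (6) $e_{\bar 1}^2=\delta\cdot e_{\bar 1}$. Diagrammatically, $e_{\bar 1}$ is drawn as a cap and a cup each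 carrying a dot, and dots must be reachable from the left boundary of a diagram. **Monoidal and ribbon structures.** The crossing is $\mathrm{id}_{\bullet^{\otimes 2}}+\mathrm{coev}\circ\mathrm{ev}$. A dot on a strand not reachable from the left is interpreted by pulling that strand to the far left using crossings, putting the dot there, and pulling the strand back; the monoidal product on $\mathbf{DiTL}(-2,\infty)$ is then juxtaposition. The braiding on $\mathbf{DiTL}(-2,\infty)$ is given by the crossing and the pivotal structure by $\mathrm{ev}$ and $\mathrm{coev}$. On $\mathcal{C}$ and $\mathbf{Rep}(\mathrm{Dic}_\infty)$ one takes the flip map and the duality coming from the Hopf algebra structure.
   Formalization: DiTL(-2,∞) is taken with the interchange law for juxtaposition imposed as a further relation besides (3)–(6); it does not follow from them, and without it juxtaposition is not a monoidal product and the functor is not faithful. *)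

(* Defs.v *)
From HB Require Import structures.
From mathcomp Require Import all_boot all_order all_algebra generic_quotient.
From mathcomp Require Import complex.
From mathcomp Require Import boolp classical_sets reals trigo.

Set Implicit Arguments.
Unset Strict Implicit.
Unset Printing Implicit Defensive.

Import Order.TTheory GRing.Theory Num.Theory.
Local Open Scope ring_scope.
Local Open Scope complex_scope.
Local Open Scope quotient_scope.

Record lincat (K : fieldType) := LinCat {
  ob : Type;
  hom : ob -> ob -> lmodType K;
  idm : forall x, hom x x;
  compm : forall x y z, hom y z -> hom x y -> hom x z;
  compmA : forall x y z t (h : hom z t) (g : hom y z) (f : hom x y),
    compm h (compm g f) = compm (compm h g) f;
  comp1m : forall x y (f : hom x y), compm (idm y) f = f;
  compm1 : forall x y (f : hom x y), compm f (idm x) = f;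
  comp_linl : forall x y z (f : hom x y),
    linear (fun g : hom y z => compm g f);
  comp_linr : forall x y z (g : hom y z),
    linear (fun f : hom x y => compm g f) }.

Arguments hom {K} A x y : rename.
Arguments idm {K} A x : rename.

Record linfunctor (K : fieldType) (A B : lincat K) := LinFunctor {
  fob : ob A -> ob B;
  fhom : forall x y, hom A x y -> hom B (fob x) (fob y);
  fhom_lin : forall x y, linear (@fhom x y);
  fhom_id : forall x, fhom (idm A x) = idm B (fob x);
  fhom_comp : forall x y z (g : hom A y z) (f : hom A x y),
    fhom (compm g f) = compm (fhom g) (fhom f) }.

Definition fully_faithful (K : fieldType) (A B : lincat K)
    (F : linfunctor A B) : Prop :=
  forall x y : ob A, bijective (@fhom K A B F x y).

Definition full_subcat (K : fieldType) (A : lincat K) (I : Type)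
    (f : I -> ob A) : lincat K :=
  @LinCat K I (fun i j => hom A (f i) (f j)) (fun i => idm A (f i))
    (fun i j k => @compm K A (f i) (f j) (f k))
    (fun i j k l => @compmA K A (f i) (f j) (f k) (f l))
    (fun i j => @comp1m K A (f i) (f j)) (fun i j => @compm1 K A (f i) (f j))
    (fun i j k => @comp_linl K A (f i) (f j) (f k))
    (fun i j k => @comp_linr K A (f i) (f j) (f k)).

Section Dicyclic.
Variable (R : realType) (theta : R).
Local Notation C := R[i].

Definition dic_x : 'M[C]_2 :=
  \matrix_(i, j) (if (i == 0) && (j == 1) then -1
                  else if (i == 1) && (j == 0) then 1 else 0).

Definition dic_a : 'M[C]_2 :=
  \matrix_(i, j) (if i != j then 0
                  else if i == 0 then cos theta +i* sin theta
                  else cos theta -i* sin theta).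

Inductive Dic : 'M[C]_2 -> Prop :=
| Dic_x : Dic dic_x
| Dic_a : Dic dic_a
| Dic_1 : Dic 1
| Dic_M g h : Dic g -> Dic h -> Dic (g * h)
| Dic_V g : Dic g -> Dic g^-1.

Definition SU2 (g : 'M[C]_2) : Prop :=
  g *m (map_mx (@conjc R) g)^T = 1%:M /\ \det g = 1.

(* The values of [ract] outside the group carry no information. *)
Record rep := MkRep {
  rsp : vectType C;
  ract : 'M[C]_2 -> 'End(rsp);
  ract1 : ract 1 = \1%VF;
  ractM : forall g h, Dic g -> Dic h ->
    ract (g * h) = (ract g \o ract h)%VF }.

Definition equivariant (U W : rep) (f : 'Hom(rsp U, rsp W)) : bool :=
  `[< forall g, Dic g -> (f \o ract U g = ract W g \o f)%VF >].

Section IntertwinerSpace.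
Variables U W : rep.

Fact equivariant_submod : submod_closed (@equivariant U W).
Proof.
split=> [|c f h /asboolP Hf /asboolP Hh]; apply/asboolP => g Dg.
  by rewrite comp_lfun0l comp_lfun0r.
by rewrite comp_lfunDl comp_lfunDr -comp_lfunZl -comp_lfunZr Hf // Hh.
Qed.
HB.instance Definition _ :=
  GRing.isSubmodClosed.Build C _ (@equivariant U W) equivariant_submod.

Record intertwiner := Intertwiner {
  ihom :> 'Hom(rsp U, rsp W);
  ihomP : ihom \in @equivariant U W }.
HB.instance Definition _ := [isSub for ihom].
HB.instance Definition _ := [Choice of intertwiner by <:].
HB.instance Definition _ := [SubChoice_isSubLmodule of intertwiner by <:].
End IntertwinerSpace.


Fact equivariant_id U : \1%VF \in @equivariant U U.
Proof. by apply/asboolP => g _; rewrite comp_lfun1l comp_lfun1r. Qed.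

Fact equivariant_comp U V W (g : intertwiner V W) (f : intertwiner U V) :
  (ihom g \o ihom f)%VF \in @equivariant U W.
Proof.
have /asboolP Hf := ihomP f; have /asboolP Hg := ihomP g.
by apply/asboolP => h Dh; rewrite -comp_lfunA Hf // !comp_lfunA Hg.
Qed.

Program Definition RepDic : lincat C :=
  @LinCat C rep intertwiner
    (fun U => Intertwiner (equivariant_id U))
    (fun U V W g f => Intertwiner (equivariant_comp g f)) _ _ _ _ _.
Next Obligation. by move=> *; apply: val_inj; rewrite /= comp_lfunA. Qed.
Next Obligation. by move=> *; apply: val_inj; rewrite /= comp_lfun1l. Qed.
Next Obligation. by move=> *; apply: val_inj; rewrite /= comp_lfun1r. Qed.
Next Obligation.
move=> x y z f a u v; apply: val_inj.
by rewrite /= comp_lfunDl -comp_lfunZl.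
Qed.
Next Obligation.
move=> x y z f a u v; apply: val_inj.
by rewrite /= comp_lfunDr -comp_lfunZr.
Qed.

End Dicyclic.

Notation word n := {ffun 'I_n -> 'I_2}.

Definition wl a b (w : word (a + b)) : word a := [ffun i => w (lshift b i)].
Definition wr a b (w : word (a + b)) : word b := [ffun i => w (rshift a i)].

Section TensorPowers.
Variable R : realType.
Local Notation C := R[i].

(* V^{(x) n} in coordinates: the word w_0 ... w_(n-1) in the letters 0, 1
   indexes v_(w_0 + 1) (x) ... (x) v_(w_(n-1) + 1). *)
Definition tpow (n : nat) : vectType C := {ffun word n -> C^o}.

Definition tbas n (w : word n) : tpow n := [ffun w' => (w' == w)%:R].

Definition tmul a b (u : tpow a) (v : tpow b) : tpow (a + b) :=
  [ffun w => (u (wl w) : C) * v (wr w)].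

(* The linear map sending the basis vector of word w to f w. *)
Definition on_basis m (W : vectType C) (f : word m -> W) : 'Hom(tpow m, W) :=
  linfun (fun v : tpow m => \sum_w (v w : C) *: f w).

Definition tmap a b c d (f : 'Hom(tpow a, tpow b)) (g : 'Hom(tpow c, tpow d)) :
    'Hom(tpow (a + c), tpow (b + d)) :=
  on_basis (fun w => tmul (f (tbas (wl w))) (g (tbas (wr w)))).

Definition w2 (i j : 'I_2) : word 2 := [ffun k => if k == 0 then i else j].
Definition w0 : word 0 := [ffun=> 0].

Definition ev_V : 'Hom(tpow 2, tpow 0) :=
  on_basis (fun w => if w == w2 0 1 then tbas w0
                     else if w == w2 1 0 then - tbas w0 else 0).

Definition coev_V : 'Hom(tpow 0, tpow 2) :=
  on_basis (fun=> tbas (w2 1 0) - tbas (w2 0 1)).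

Definition e1_V : 'Hom(tpow 2, tpow 2) :=
  on_basis (fun w => if (w == w2 0 1) || (w == w2 1 0)
                     then - (tbas (w2 0 1) + tbas (w2 1 0)) else 0).

(* The diagonal action g v_j (x) g v_k (x) ... *)
Definition tact n (g : 'M[C]_2) : 'End(tpow n) :=
  on_basis (fun w => [ffun w' : word n => \prod_i g (w' i) (w i)] : tpow n).

Fact on_basis_linear m (W : vectType C) (f : word m -> W) :
  linear (fun v : tpow m => \sum_w (v w : C) *: f w).
Proof.
move=> a u v; rewrite scaler_sumr -big_split /=; apply: eq_bigr => w _.
by rewrite !ffunE scalerDl scalerA.
Qed.

Lemma on_basisE m (W : vectType C) (f : word m -> W) v :
  on_basis f v = \sum_w (v w : C) *: f w.
Proof.
pose F (v : tpow m) : W := \sum_w (v w : C) *: f w.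
pose L := GRing.isLinear.Build _ _ _ _ F (on_basis_linear f).
pose FL : {linear tpow m -> W} := HB.pack F L.
by rewrite /on_basis (lfunE FL).
Qed.

Lemma on_basis_tbas m (W : vectType C) (f : word m -> W) w :
  on_basis f (tbas w) = f w.
Proof.
rewrite on_basisE (bigD1 w) //= ffunE eqxx scale1r big1 ?addr0 // => w' nw.
by rewrite ffunE (negPf nw) scale0r.
Qed.

Fact tpow_sumE n (I : finType) (F : I -> tpow n) w :
  (\sum_i F i) w = \sum_i (F i w : C).
Proof.
by elim/big_rec2: _ => [|i x y _ <-]; rewrite ffunE.
Qed.

Lemma tpow_sum n (v : tpow n) : v = \sum_w (v w : C) *: tbas w.
Proof.
apply/ffunP => w; rewrite tpow_sumE.
have E w' : ((v w' : C) *: tbas w' : tpow n) w = v w' * (w == w')%:R.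
  by rewrite !ffunE.
under eq_bigr do rewrite E.
rewrite (bigD1 w) //= eqxx mulr1 big1 ?addr0 // => w' nw.
by rewrite eq_sym (negPf nw) mulr0.
Qed.

Lemma tpow_hom_ext m (W : vectType C) (f g : 'Hom(tpow m, W)) :
  (forall w, f (tbas w) = g (tbas w)) -> f = g.
Proof.
move=> fg; apply/lfunP => v; rewrite (tpow_sum v) !linear_sum /=.
by apply: eq_bigr => w _; rewrite !linearZ /= fg.
Qed.

Fact tact_tbas n g (w : word n) :
  tact n g (tbas w) = [ffun w' : word n => \prod_i g (w' i) (w i)].
Proof. exact: on_basis_tbas. Qed.

Fact tact1 n : tact n 1 = \1%VF.
Proof.
apply: tpow_hom_ext => w; rewrite tact_tbas id_lfunE.
apply/ffunP => w'; rewrite !ffunE; case: eqP => [->|/eqP nw].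
  by apply: big1 => i _; rewrite mxE eqxx.
have [i ni] : exists i, w' i != w i.
  by apply/existsP; apply: contraNT nw; rewrite negb_exists => /forallP H;
     apply/eqP/ffunP => i; apply/eqP; rewrite -[_ == _]negbK.
by rewrite (bigD1 i) //= mxE (negPf ni) mul0r.
Qed.

Fact tactM n g h : tact n (g * h) = (tact n g \o tact n h)%VF.
Proof.
apply: tpow_hom_ext => w; apply: etrans (tact_tbas _ _) _; apply: esym.
apply: etrans (comp_lfunE _ _ _) _.
apply: etrans (congr1 _ (tact_tbas _ _)) _; rewrite on_basisE.
apply/ffunP => w'; rewrite tpow_sumE [RHS]ffunE.
under [RHS] eq_bigr do rewrite mxE.
rewrite bigA_distr_bigA; apply: eq_bigr => u _.
rewrite !ffunE /GRing.scale /= -big_split /=.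
by apply: eq_bigr => i _; rewrite mulrC.
Qed.

Definition Vpow theta n : rep theta :=
  @MkRep R theta (tpow n) (tact n) (tact1 n) (fun g h _ _ => tactM n g h).

End TensorPowers.

Section Diagrams.
Variable R : realType.
Local Notation C := R[i].

Definition delta : C := - 2%:R.

Variant kind := TL | DiTL.

(* Morphism terms.  [Tens] is at the same time the monoidal product of TL
   (k = TL) and the right action of TL on its module category DiTL
   (k = DiTL), whose object n is the object 0 acted on by n points. *)
Inductive dia : kind -> nat -> nat -> Type :=
| Id k n : dia k n n
| Comp k m n p : dia k n p -> dia k m n -> dia k m p
| Zero k m n : dia k m n
| Add k m n : dia k m n -> dia k m n -> dia k m n
| Scale k m n : C -> dia k m n -> dia k m n
| Tens k a b c d : dia k a b -> dia TL c d -> dia k (a + c) (b + d)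
| Ev : dia TL 2 0
| Coev : dia TL 0 2
| E1 : dia DiTL 2 2.

Definition dcast k m n m' n' (em : m = m') (en : n = n') (f : dia k m n) :
    dia k m' n' :=
  ecast q (dia k m' q) en (ecast p (dia k p n) em f).

(* A TL diagram regarded as an undecorated diagram of DiTL. *)
Definition undec m n (t : dia TL m n) : dia DiTL m n := Tens (Id DiTL 0) t.

Definition cross : dia TL 2 2 := Add (Id TL 2) (Comp Coev Ev).

Fixpoint cross1 b : dia TL (1 + b) (b + 1) :=
  match b with
  | 0 => Id TL 1
  | b'.+1 => Comp (Tens (Id TL 1) (cross1 b')) (Tens cross (Id TL b'))
  end.

(* a strands on the left crossing b strands on the right *)
Fixpoint crossing a b : dia TL (a + b) (b + a) :=
  match a with
  | 0 => dcast (erefl b) (esym (addn0 b)) (Id TL b)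
  | a'.+1 => dcast (erefl (a'.+1 + b)%N) (esym (addnA b 1 a'))
      (Comp (Tens (cross1 b) (Id TL a')) (Tens (Id TL 1) (crossing a' b)))
  end.

(* id_a (x) g.  A right module category has no such operation: the dots of g
   are pulled to the far left through the a strands and back.  For delta = -2
   the crossing is its own inverse, so over and under do not matter. *)
Definition pull a c d (g : dia DiTL c d) : dia DiTL (a + c) (a + d) :=
  Comp (undec (crossing d a)) (Comp (Tens g (Id TL a)) (undec (crossing a c))).

Definition juxt a b c d (f : dia DiTL a b) (g : dia DiTL c d) :
    dia DiTL (a + c) (b + d) :=
  Comp (Tens f (Id TL d)) (pull a g).

Inductive deq : forall k m n, dia k m n -> dia k m n -> Prop :=
| deq_refl k m n (f : dia k m n) : deq f f
| deq_sym k m n (f g : dia k m n) : deq f g -> deq g f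
| deq_trans k m n (f g h : dia k m n) : deq f g -> deq g h -> deq f h
| deq_Comp k m n p (f f' : dia k n p) (g g' : dia k m n) :
    deq f f' -> deq g g' -> deq (Comp f g) (Comp f' g')
| deq_Add k m n (f f' g g' : dia k m n) :
    deq f f' -> deq g g' -> deq (Add f g) (Add f' g')
| deq_Scale k m n c (f f' : dia k m n) :
    deq f f' -> deq (Scale c f) (Scale c f')
| deq_Tens k a b c d (f f' : dia k a b) (g g' : dia TL c d) :
    deq f f' -> deq g g' -> deq (Tens f g) (Tens f' g')
| deq_addA k m n (f g h : dia k m n) :
    deq (Add f (Add g h)) (Add (Add f g) h)
| deq_addC k m n (f g : dia k m n) : deq (Add f g) (Add g f)
| deq_add0 k m n (f : dia k m n) : deq (Add (Zero k m n) f) f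
| deq_addN k m n (f : dia k m n) :
    deq (Add (Scale (- 1) f) f) (Zero k m n)
| deq_scale1 k m n (f : dia k m n) : deq (Scale 1 f) f
| deq_scaleA k m n c c' (f : dia k m n) :
    deq (Scale c (Scale c' f)) (Scale (c * c') f)
| deq_scaleDr k m n c (f g : dia k m n) :
    deq (Scale c (Add f g)) (Add (Scale c f) (Scale c g))
| deq_scaleDl k m n c c' (f : dia k m n) :
    deq (Scale (c + c') f) (Add (Scale c f) (Scale c' f))
| deq_compA k m n p q (f : dia k p q) (g : dia k n p) (h : dia k m n) :
    deq (Comp f (Comp g h)) (Comp (Comp f g) h)
| deq_comp1l k m n (f : dia k m n) : deq (Comp (Id k n) f) f
| deq_comp1r k m n (f : dia k m n) : deq (Comp f (Id k m)) f
| deq_compDl k m n p (f f' : dia k n p) (g : dia k m n) :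
    deq (Comp (Add f f') g) (Add (Comp f g) (Comp f' g))
| deq_compDr k m n p (f : dia k n p) (g g' : dia k m n) :
    deq (Comp f (Add g g')) (Add (Comp f g) (Comp f g'))
| deq_compZl k m n p c (f : dia k n p) (g : dia k m n) :
    deq (Comp (Scale c f) g) (Scale c (Comp f g))
| deq_compZr k m n p c (f : dia k n p) (g : dia k m n) :
    deq (Comp f (Scale c g)) (Scale c (Comp f g))
(* monoidal axioms when k = TL, module-category axioms when k = DiTL *)
| deq_tensDl k a b c d (f f' : dia k a b) (g : dia TL c d) :
    deq (Tens (Add f f') g) (Add (Tens f g) (Tens f' g))
| deq_tensDr k a b c d (f : dia k a b) (g g' : dia TL c d) :
    deq (Tens f (Add g g')) (Add (Tens f g) (Tens f g'))
| deq_tensZl k a b c d z (f : dia k a b) (g : dia TL c d) :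
    deq (Tens (Scale z f) g) (Scale z (Tens f g))
| deq_tensZr k a b c d z (f : dia k a b) (g : dia TL c d) :
    deq (Tens f (Scale z g)) (Scale z (Tens f g))
| deq_tens1 k a b : deq (Tens (Id k a) (Id TL b)) (Id k (a + b))
| deq_tens_comp k a b c a' b' c' (f : dia k b c) (g : dia k a b)
    (f' : dia TL b' c') (g' : dia TL a' b') :
    deq (Tens (Comp f g) (Comp f' g')) (Comp (Tens f f') (Tens g g'))
| deq_tensA k a b c d p q (f : dia k a b) (g : dia TL c d) (h : dia TL p q) :
    deq (dcast (addnA a c p) (addnA b d q) (Tens f (Tens g h)))
        (Tens (Tens f g) h)
| deq_tensr1 k a b (f : dia k a b) :
    deq (dcast (addn0 a) (addn0 b) (Tens f (Id TL 0))) f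
| deq_tensl1 a b (f : dia TL a b) :
    deq (Tens (Id TL 0) f : dia TL a b) f
| deq_loop : deq (Comp Ev Coev) (Scale delta (Id TL 0))
| deq_zigzagl :
    deq (Comp (Tens Ev (Id TL 1) : dia TL 3 1) (Tens (Id TL 1) Coev)) (Id TL 1)
| deq_zigzagr :
    deq (Comp (Tens (Id TL 1) Ev : dia TL 3 1) (Tens Coev (Id TL 1))) (Id TL 1)
| deq_E1_right :
    deq (Comp (undec (Tens (Id TL 1) Ev) : dia DiTL 3 1)
              (Comp (Tens E1 (Id TL 1)) (undec (Tens (Id TL 1) Coev))))
        (Id DiTL 1)
| deq_E1_left :
    deq (Comp (undec (Tens Ev (Id TL 1)) : dia DiTL 3 1)
              (Comp (pull 1 E1) (undec (Tens Coev (Id TL 1)))))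
        (Id DiTL 1)
| deq_E1_coev : deq (Comp E1 (undec Coev)) (Zero DiTL 0 2)
| deq_ev_E1 : deq (Comp (undec Ev) E1) (Zero DiTL 2 0)
| deq_E1_sq : deq (Comp E1 E1) (Scale delta E1)
(* Interchange law for [juxt].  It does not follow from the relations above,
   and juxtaposition is a monoidal product on DiTL only because of it. *)
| deq_slide a b c d (f : dia DiTL a b) (g : dia DiTL c d) :
    deq (Comp (Tens f (Id TL d)) (pull a g))
        (Comp (pull b g) (Tens f (Id TL c))).

HB.instance Definition _ k m n := gen_eqMixin (dia k m n).
HB.instance Definition _ k m n := gen_choiceMixin (dia k m n).

Definition deqb k m n (f g : dia k m n) : bool := `[< deq f g >].

Fact deqb_refl k m n : reflexive (@deqb k m n).
Proof. by move=> f; apply/asboolP/deq_refl. Qed.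
Fact deqb_sym k m n : symmetric (@deqb k m n).
Proof. by move=> f g; apply/asboolP/asboolP; apply: deq_sym. Qed.
Fact deqb_trans k m n : transitive (@deqb k m n).
Proof.
by move=> g f h /asboolP fg /asboolP gh; apply/asboolP/(deq_trans fg gh).
Qed.
Canonical deq_equiv k m n :=
  EquivRel (@deqb k m n) (@deqb_refl k m n) (@deqb_sym k m n)
    (@deqb_trans k m n).

Definition DHom k m n := {eq_quot (@deq_equiv k m n)}.
HB.instance Definition _ k m n := Choice.on (DHom k m n).

Definition cls k m n (f : dia k m n) : DHom k m n := \pi f.

Lemma clsP k m n (f g : dia k m n) : cls f = cls g <-> deq f g.
Proof.
split=> [|fg]; first by move/eqmodP/asboolP.
by apply/eqmodP/asboolP.
Qed.

Lemma clsK k m n (u : DHom k m n) : cls (repr u) = u.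
Proof. exact: reprK. Qed.

Lemma reprP k m n (f : dia k m n) : deq (repr (cls f)) f.
Proof. by apply/clsP; rewrite clsK. Qed.

Definition cadd k m n (u v : DHom k m n) := cls (Add (repr u) (repr v)).
Definition cscale k m n c (u : DHom k m n) := cls (Scale c (repr u)).
Definition ccomp k m n p (u : DHom k n p) (v : DHom k m n) :=
  cls (Comp (repr u) (repr v)).

Lemma caddE k m n (f g : dia k m n) : cadd (cls f) (cls g) = cls (Add f g).
Proof. by apply/clsP; apply: deq_Add; apply: reprP. Qed.
Lemma cscaleE k m n c (f : dia k m n) : cscale c (cls f) = cls (Scale c f).
Proof. by apply/clsP; apply: deq_Scale; apply: reprP. Qed.
Lemma ccompE k m n p (f : dia k n p) (g : dia k m n) :
  ccomp (cls f) (cls g) = cls (Comp f g).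
Proof. by apply/clsP; apply: deq_Comp; apply: reprP. Qed.

Section HomSpace.
Variables (k : kind) (m n : nat).
Implicit Types u v w : DHom k m n.

Fact caddA : associative (@cadd k m n).
Proof.
move=> u v w; rewrite -[u]clsK -[v]clsK -[w]clsK !caddE.
exact/clsP/deq_addA.
Qed.
Fact caddC : commutative (@cadd k m n).
Proof. by move=> u v; rewrite -[u]clsK -[v]clsK !caddE; exact/clsP/deq_addC. Qed.
Fact cadd0 : left_id (cls (Zero k m n)) (@cadd k m n).
Proof. by move=> u; rewrite -[u]clsK !caddE; exact/clsP/deq_add0. Qed.
Fact caddN : left_inverse (cls (Zero k m n)) (cscale (- 1)) (@cadd k m n).
Proof. by move=> u; rewrite -[u]clsK cscaleE caddE; exact/clsP/deq_addN. Qed.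
HB.instance Definition _ :=
  GRing.isZmodule.Build (DHom k m n) caddA caddC cadd0 caddN.

Fact cscaleA a b u : cscale a (cscale b u) = cscale (a * b) u.
Proof. by rewrite -[u]clsK !cscaleE; exact/clsP/deq_scaleA. Qed.
Fact cscale1 : left_id 1 (@cscale k m n).
Proof. by move=> u; rewrite -[u]clsK !cscaleE; exact/clsP/deq_scale1. Qed.
Fact cscaleDr : right_distributive (@cscale k m n) +%R.
Proof.
move=> c u v; rewrite -[u]clsK -[v]clsK.
by rewrite [_ + _]caddE !cscaleE [_ + _]caddE; exact/clsP/deq_scaleDr.
Qed.
Fact cscaleDl u : {morph (@cscale k m n)^~ u : a b / a + b}.
Proof.
move=> a b; rewrite -[u]clsK !cscaleE [RHS]caddE; exact/clsP/deq_scaleDl.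
Qed.
HB.instance Definition _ :=
  GRing.Zmodule_isLmodule.Build C (DHom k m n)
    cscaleA cscale1 cscaleDr cscaleDl.
End HomSpace.

Lemma cls_lin k m n c (f g : dia k m n) :
  c *: cls f + cls g = cls (Add (Scale c f) g).
Proof. by rewrite [_ *: _]cscaleE [_ + _]caddE. Qed.

Program Definition dia_cat (k : kind) : lincat C :=
  @LinCat C nat (fun m n => DHom k m n) (fun n => cls (Id k n))
    (fun m n p => @ccomp k m n p) _ _ _ _ _.
Next Obligation.
move=> k m n p q f g h; rewrite -[f]clsK -[g]clsK -[h]clsK !ccompE.
exact/clsP/deq_compA.
Qed.
Next Obligation.
by move=> k m n f; rewrite -[f]clsK ccompE; exact/clsP/deq_comp1l.
Qed.
Next Obligation.
by move=> k m n f; rewrite -[f]clsK ccompE; exact/clsP/deq_comp1r.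
Qed.
Next Obligation.
move=> k m n p f c u v /=; rewrite -[f]clsK -[u]clsK -[v]clsK.
rewrite cls_lin !ccompE cls_lin; apply/clsP.
apply: deq_trans (deq_compDl _ _ _) _.
by apply: deq_Add (deq_refl _); apply: deq_compZl.
Qed.
Next Obligation.
move=> k m n p f c u v /=; rewrite -[f]clsK -[u]clsK -[v]clsK.
rewrite cls_lin !ccompE cls_lin; apply/clsP.
apply: deq_trans (deq_compDr _ _ _) _.
by apply: deq_Add (deq_refl _); apply: deq_compZr.
Qed.

End Diagrams.

Section Functor.
Variable R : realType.
Local Notation C := R[i].
Local Notation dia := (dia R).
Local Notation tpow := (@tpow R).

Fixpoint sem k m n (f : dia k m n) : 'Hom(tpow m, tpow n) :=
  match f with
  | Id _ n => \1%VF
  | Comp _ _ _ _ f g => (sem f \o sem g)%VF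
  | Zero _ _ _ => 0
  | Add _ _ _ f g => sem f + sem g
  | Scale _ _ _ c f => c *: sem f
  | Tens _ _ _ _ _ f g => tmap (sem f) (sem g)
  | Ev => ev_V R
  | Coev => coev_V R
  | E1 => e1_V R
  end.

Definition wseq n (s : seq 'I_2) : word n := [ffun i : 'I_n => nth 0 s i].
Definition wlist n (w : word n) : seq 'I_2 := [seq w i | i <- enum 'I_n].
Implicit Types (s t : seq 'I_2) (i j : 'I_2).
Local Notation ket s := (tbas R (wseq _ s)).

Fact size_wlist n (w : word n) : size (wlist w) = n.
Proof. by rewrite size_map size_enum_ord. Qed.

Fact wlistK n (w : word n) : wseq n (wlist w) = w.
Proof.
apply/ffunP => i; rewrite ffunE (nth_map i) ?size_enum_ord //.
by rewrite nth_ord_enum.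
Qed.

Fact wseq_inj n (s t : seq 'I_2) : size s = n -> size t = n ->
  (wseq n s == wseq n t) = (s == t).
Proof.
move=> Hs Ht; apply/eqP/eqP => [/ffunP E|-> //].
apply: (@eq_from_nth _ 0) => [|i]; first by rewrite Hs Ht.
by rewrite Hs => Hi; have := E (Ordinal Hi); rewrite !ffunE.
Qed.

Fact wl_seq a b (s t : seq 'I_2) : size s = a ->
  wl (wseq (a + b) (s ++ t)) = wseq a s.
Proof.
by move=> Hs; apply/ffunP => i; rewrite !ffunE /= nth_cat Hs ltn_ord.
Qed.

Fact wr_seq a b (s t : seq 'I_2) : size s = a ->
  wr (wseq (a + b) (s ++ t)) = wseq b t.
Proof.
move=> Hs; apply/ffunP => i; rewrite !ffunE /= nth_cat Hs.
by rewrite ltnNge leq_addr /= addKn.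
Qed.

Fact wordS a b (w : word (a + b)) :
  exists s t, [/\ size s = a, size t = b & w = wseq (a + b) (s ++ t)].
Proof.
exists (take a (wlist w)), (drop a (wlist w)).
rewrite cat_take_drop wlistK size_drop size_take size_wlist addKn; split=> //.
by case: b w => [|b] w; rewrite ?addn0 ?ltnn // addnS ltnS leq_addr.
Qed.

Fact w2E i j : w2 i j = wseq 2 [:: i; j].
Proof.
by apply/ffunP => k; rewrite !ffunE; case: k => [[|[|]]] //= Hk.
Qed.

Fact tmul_bas a b s t : size s = a -> size t = b ->
  tmul ((ket s) : tpow a) ((ket t) : tpow b) = (ket (s ++ t)).
Proof.
move=> Hs Ht; apply/ffunP => w; have [s' [t' [Hs' Ht' ->]]] := wordS w.
rewrite !ffunE wl_seq // wr_seq // !wseq_inj ?size_cat ?Hs ?Hs' ?Ht ?Ht' //.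
rewrite eqseq_cat ?Hs ?Hs' //.
by case: (s' == s); case: (t' == t); rewrite /= ?mulr1 ?mulr0 ?mul0r.
Qed.

Fact tmulDl a b (u u' : tpow a) (v : tpow b) :
  tmul (u + u') v = tmul u v + tmul u' v.
Proof. by apply/ffunP => w; rewrite !ffunE mulrDl. Qed.
Fact tmulDr a b (u : tpow a) (v v' : tpow b) :
  tmul u (v + v') = tmul u v + tmul u v'.
Proof. by apply/ffunP => w; rewrite !ffunE mulrDr. Qed.
Fact tmulZl a b c (u : tpow a) (v : tpow b) : tmul (c *: u) v = c *: tmul u v.
Proof. by apply/ffunP => w; rewrite !ffunE /GRing.scale /= mulrA. Qed.
Fact tmulZr a b c (u : tpow a) (v : tpow b) : tmul u (c *: v) = c *: tmul u v.
Proof. by apply/ffunP => w; rewrite !ffunE /GRing.scale /= mulrCA. Qed.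
Fact tmul0l a b (v : tpow b) : tmul (0 : tpow a) v = 0.
Proof. by apply/ffunP => w; rewrite !ffunE mul0r. Qed.
Fact tmul0r a b (u : tpow a) : tmul u (0 : tpow b) = 0.
Proof. by apply/ffunP => w; rewrite !ffunE mulr0. Qed.
Fact tmulNl a b (u : tpow a) (v : tpow b) : tmul (- u) v = - tmul u v.
Proof. by rewrite -scaleN1r tmulZl scaleN1r. Qed.
Fact tmulNr a b (u : tpow a) (v : tpow b) : tmul u (- v) = - tmul u v.
Proof. by rewrite -scaleN1r tmulZr scaleN1r. Qed.
Fact tmul_suml a b (I : finType) (F : I -> tpow a) (v : tpow b) :
  tmul (\sum_i F i) v = \sum_i tmul (F i) v.
Proof.
by elim/big_rec2: _ => [|i x y _ <-]; rewrite ?tmul0l // tmulDl.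
Qed.
Fact tmul_sumr a b (I : finType) (F : I -> tpow b) (u : tpow a) :
  tmul u (\sum_i F i) = \sum_i tmul u (F i).
Proof.
by elim/big_rec2: _ => [|i x y _ <-]; rewrite ?tmul0r // tmulDr.
Qed.

(* A linear map is determined by its values on pure tensors. *)
Fact tmul_ext a b (W : vectType C) (f g : 'Hom(tpow (a + b), W)) :
  (forall s t, size s = a -> size t = b ->
     f (tmul (ket s) (ket t)) = g (tmul (ket s) (ket t))) -> f = g.
Proof.
move=> fg; apply: tpow_hom_ext => w; have [s [t [Hs Ht ->]]] := wordS w.
by rewrite -(tmul_bas Hs Ht) fg.
Qed.

Fact bilin_ext a b (W : vectType C) (f : 'Hom(tpow (a + b), W))
    (h : tpow a -> tpow b -> W) :
  (forall u, linear (h u)) -> (forall v, linear (h^~ v)) ->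
  (forall s t, size s = a -> size t = b -> f (tmul (ket s) (ket t)) = h (ket s) (ket t)) ->
  forall u v, f (tmul u v) = h u v.
Proof.
move=> Hr Hl H u v.
pose Lr u := GRing.isLinear.Build _ _ _ _ (h u) (Hr u).
pose Ll v := GRing.isLinear.Build _ _ _ _ (h^~ v) (Hl v).
pose hr u : {linear tpow b -> W} := HB.pack (h u) (Lr u).
pose hl v : {linear tpow a -> W} := HB.pack (h^~ v) (Ll v).
rewrite (tpow_sum u) (tpow_sum v) tmul_suml linear_sum.
rewrite -[RHS]/(hl _ _) linear_sum; apply: eq_bigr => w _.
rewrite tmul_sumr linear_sum -[RHS]/(hr _ _) linear_sum.
apply: eq_bigr => w' _.
rewrite tmulZr tmulZl !linearZ /=; congr (_ *: _).
rewrite -[RHS]/(hl _ _) linearZ /=; congr (_ *: _).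
by rewrite -[w]wlistK -[w']wlistK H ?size_wlist.
Qed.

Lemma tmap_tmul a b c d (f : 'Hom(tpow a, tpow b)) (g : 'Hom(tpow c, tpow d))
    u v : tmap f g (tmul u v) = tmul (f u) (g v).
Proof.
move: u v; apply: bilin_ext.
- by move=> u z v v'; rewrite linearP tmulDr tmulZr.
- by move=> v z u u'; rewrite linearP tmulDl tmulZl.
move=> s t Hs Ht; rewrite (tmul_bas Hs Ht) on_basis_tbas.
by rewrite wl_seq // wr_seq.
Qed.

Fact tmapDl a b c d (f f' : 'Hom(tpow a, tpow b)) (g : 'Hom(tpow c, tpow d)) :
  tmap (f + f') g = tmap f g + tmap f' g.
Proof.
apply: tmul_ext => s t _ _; apply: etrans (tmap_tmul _ _ _ _) _.
apply: esym; apply: etrans (add_lfunE _ _ _) _.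
apply: etrans (congr2 +%R (tmap_tmul _ _ _ _) (tmap_tmul _ _ _ _)) _.
by apply: etrans (esym (tmulDl _ _ _)) _; congr tmul; rewrite add_lfunE.
Qed.
Fact tmapDr a b c d (f : 'Hom(tpow a, tpow b)) (g g' : 'Hom(tpow c, tpow d)) :
  tmap f (g + g') = tmap f g + tmap f g'.
Proof.
apply: tmul_ext => s t _ _; apply: etrans (tmap_tmul _ _ _ _) _.
apply: esym; apply: etrans (add_lfunE _ _ _) _.
apply: etrans (congr2 +%R (tmap_tmul _ _ _ _) (tmap_tmul _ _ _ _)) _.
by apply: etrans (esym (tmulDr _ _ _)) _; congr tmul; rewrite add_lfunE.
Qed.
Fact tmapZl a b c d z (f : 'Hom(tpow a, tpow b)) (g : 'Hom(tpow c, tpow d)) :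
  tmap (z *: f) g = z *: tmap f g.
Proof.
apply: tmul_ext => s t _ _; apply: etrans (tmap_tmul _ _ _ _) _.
apply: esym; apply: etrans (scale_lfunE _ _ _) _.
apply: etrans (congr1 ( *:%R z) (tmap_tmul _ _ _ _)) _.
by apply: etrans (esym (tmulZl _ _ _)) _; congr tmul; rewrite scale_lfunE.
Qed.
Fact tmapZr a b c d z (f : 'Hom(tpow a, tpow b)) (g : 'Hom(tpow c, tpow d)) :
  tmap f (z *: g) = z *: tmap f g.
Proof.
apply: tmul_ext => s t _ _; apply: etrans (tmap_tmul _ _ _ _) _.
apply: esym; apply: etrans (scale_lfunE _ _ _) _.
apply: etrans (congr1 ( *:%R z) (tmap_tmul _ _ _ _)) _.
by apply: etrans (esym (tmulZr _ _ _)) _; congr tmul; rewrite scale_lfunE.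
Qed.

Fact tmap_bas a b c d (f : 'Hom(tpow a, tpow b)) (g : 'Hom(tpow c, tpow d))
    s t : size s = a -> size t = c ->
  tmap f g ((ket (s ++ t))) = tmul (f (ket s)) (g (ket t)).
Proof. by move=> Hs Ht; rewrite -tmul_bas // tmap_tmul. Qed.

Fact tmap1 a b : tmap \1 \1 = \1%VF :> 'End(tpow (a + b)).
Proof. by apply: tmul_ext => s t _ _; rewrite tmap_tmul !id_lfunE. Qed.

Fact tmap_comp a b c a' b' c' (f : 'Hom(tpow b, tpow c))
    (g : 'Hom(tpow a, tpow b)) (f' : 'Hom(tpow b', tpow c'))
    (g' : 'Hom(tpow a', tpow b')) :
  tmap (f \o g) (f' \o g') = (tmap f f' \o tmap g g')%VF.
Proof.
by apply: tmul_ext => s t _ _; rewrite comp_lfunE !tmap_tmul !comp_lfunE.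
Qed.

Fact sem_dcast k m n m' n' (em : m = m') (en : n = n') (f : dia k m n) s t :
  (sem (dcast em en f) (ket s) : tpow n') (wseq n' t) =
  (sem f (ket s) : tpow n) (wseq n t).
Proof. by case: _ / em; case: _ / en. Qed.

Fact sem_dcast_bas k m n m' n' (em : m = m') (en : n = n') (f : dia k m n) s t :
  sem f (ket s) = (ket t) -> sem (dcast em en f) (ket s) = (ket t).
Proof. by case: _ / em; case: _ / en. Qed.

Fact seq_ext m n (f g : 'Hom(tpow m, tpow n)) :
  (forall s t, size s = m -> size t = n ->
     f (ket s) (wseq n t) = g (ket s) (wseq n t)) -> f = g.
Proof.
move=> fg; apply: tpow_hom_ext => w; apply/ffunP => w'.
by rewrite -[w]wlistK -[w']wlistK fg ?size_wlist.
Qed.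

Fact tmapE a b c d (f : 'Hom(tpow a, tpow b)) (g : 'Hom(tpow c, tpow d))
    s t s' t' : size s = a -> size t = c -> size s' = b -> size t' = d ->
  (tmap f g (ket (s ++ t))) (wseq _ (s' ++ t')) =
  (f (ket s) (wseq b s') : C) * g (ket t) (wseq d t').
Proof.
by move=> Hs Ht Hs' Ht'; rewrite tmap_bas // ffunE wl_seq // wr_seq.
Qed.

Fact tmapl1 a b (f : 'Hom(tpow a, tpow b)) :
  tmap (\1 : 'End(tpow 0)) f = f.
Proof.
apply: seq_ext => s t Hs Ht.
rewrite -[s]cat0s -[t]cat0s (tmapE _ _ (erefl : size [::] = 0%N) Hs) //.
rewrite id_lfunE ffunE.
by rewrite (_ : _ == _ = true) ?mul1r //; apply/eqP/ffunP => -[].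
Qed.

Fact size_catP a b (s : seq 'I_2) : size s = (a + b)%N ->
  exists s1 s2, [/\ s = s1 ++ s2, size s1 = a & size s2 = b].
Proof.
move=> Hs; exists (take a s), (drop a s).
rewrite cat_take_drop size_drop size_take Hs addKn; split=> //.
by case: b Hs => [|b] Hs; rewrite ?addn0 ?ltnn // addnS ltnS leq_addr.
Qed.

Fact size0P (s : seq 'I_2) : size s = 0%N -> s = [::].
Proof. exact: size0nil. Qed.

Fact ev_bas i j : ev_V R (ket ([:: i; j])) =
  if (i == 0) && (j == 1) then (ket ([::]))
  else if (i == 1) && (j == 0) then - (ket ([::])) else 0.
Proof.
have E0 : w0 = wseq 0 [::] by apply/ffunP => -[].
by rewrite on_basis_tbas !w2E !wseq_inj // !eqseq_cons !andbT E0.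
Qed.

Fact coev_bas s : coev_V R (ket s) = (ket ([:: 1; 0])) - (ket ([:: 0; 1])).
Proof. by rewrite on_basis_tbas !w2E. Qed.

Fact e1_bas i j : e1_V R (ket ([:: i; j])) =
  if i != j then - ((ket ([:: 0; 1])) + (ket ([:: 1; 0]))) else 0.
Proof.
rewrite on_basis_tbas !w2E !wseq_inj // !eqseq_cons !andbT.
by case: i => [[|[|]]] // ?; case: j => [[|[|]]].
Qed.

Fact I2P (i : 'I_2) : i = 0 \/ i = 1.
Proof. by case: i => [[|[|]]] // ?; [left|right]; apply: val_inj. Qed.

Fact cross_bas i j : sem (cross R) (ket ([:: i; j])) = (ket ([:: j; i])).
Proof.
rewrite /= add_lfunE comp_lfunE id_lfunE ev_bas.
case: (I2P i) => ->; case: (I2P j) => -> /=; rewrite ?linear0 ?addr0 //.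
  by rewrite coev_bas addrC subrK.
by rewrite linearN /= coev_bas opprB addrC subrK.
Qed.

Fact cross1_bas b i s : size s = b ->
  sem (cross1 R b) (ket (i :: s)) = (ket (rcons s i)).
Proof.
elim: b i s => [|b IH] i [|j s] // => [_|[Hs]].
  by rewrite /= id_lfunE.
have E1 : sem (Tens (cross R) (Id R TL b)) (ket (i :: j :: s)) =
          ket (j :: i :: s) :> tpow (2 + b).
  rewrite -[i :: _]/([:: i; j] ++ s) [LHS]tmap_bas // cross_bas.
  by rewrite id_lfunE tmul_bas.
have E2 : sem (Tens (Id R TL 1) (cross1 R b)) (ket (j :: i :: s)) =
          ket (j :: rcons s i) :> tpow (1 + (b + 1)).
  rewrite -[j :: _]/([:: j] ++ (i :: s)) [LHS]tmap_bas //= ?Hs //.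
  by rewrite id_lfunE IH // tmul_bas // size_rcons Hs addn1.
rewrite [LHS]comp_lfunE; apply: etrans E2.
by congr (_ _); exact: E1.
Qed.

Fact crossing_bas a b s t : size s = a -> size t = b ->
  sem (crossing R a b) (ket (s ++ t)) = (ket (t ++ s)).
Proof.
elim: a s => [|a IH] [|i s] // Hs Ht.
  by apply: sem_dcast_bas; rewrite id_lfunE cats0.
move: Hs => /= [Hs]; apply: sem_dcast_bas.
have E1 : sem (Tens (Id R TL 1) (crossing R a b)) (ket (i :: s ++ t)) =
          ket (i :: t ++ s) :> tpow (1 + (b + a)).
  rewrite -[i :: (s ++ t)]/([:: i] ++ (s ++ t)) [LHS]tmap_bas //=.
    by rewrite id_lfunE IH // tmul_bas // size_cat Ht Hs.
  by rewrite size_cat Ht Hs.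
have E2 : sem (Tens (cross1 R b) (Id R TL a)) (ket (i :: t ++ s)) =
          ket (t ++ i :: s) :> tpow (b + 1 + a).
  rewrite -[i :: (t ++ s)]/((i :: t) ++ s) [LHS]tmap_bas //= ?Ht //.
  by rewrite id_lfunE cross1_bas // tmul_bas ?size_rcons ?Ht ?addn1 // cat_rcons.
rewrite [LHS]comp_lfunE; apply: etrans E2.
by congr (_ _); exact: E1.
Qed.

Lemma sem_crossing a b (u : tpow a) (v : tpow b) :
  sem (crossing R a b) (tmul u v) = tmul v u.
Proof.
move: u v; apply: bilin_ext.
- by move=> u z v v'; rewrite tmulDl tmulZl.
- by move=> v z u u'; rewrite tmulDr tmulZr.
by move=> s t Hs Ht; rewrite !tmul_bas // crossing_bas.
Qed.

Fact sem_Comp k m n p (f : dia k n p) (g : dia k m n) :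
  sem (Comp f g) = (sem f \o sem g)%VF.
Proof. by []. Qed.

Lemma sem_undec m n (t : dia TL m n) : sem (undec t) = sem t.
Proof. exact: tmapl1. Qed.

Lemma sem_pull a c d (g : dia DiTL c d) : sem (pull a g) = tmap \1 (sem g).
Proof.
apply: tmul_ext => s t _ _.
rewrite /pull !sem_Comp !comp_lfunE !sem_undec.
by rewrite sem_crossing /= tmap_tmul sem_crossing tmap_tmul.
Qed.

Lemma sem_juxt a b c d (f : dia DiTL a b) (g : dia DiTL c d) :
  sem (juxt f g) = tmap (sem f) (sem g).
Proof.
rewrite /juxt sem_Comp sem_pull /= -tmap_comp.
by rewrite comp_lfun1l comp_lfun1r.
Qed.

Local Notation I1 := (\1%VF : 'End(tpow 1)).

Definition eps (i j : 'I_2) : C :=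
  if (i == 0) && (j == 1) then 1 else if (i == 1) && (j == 0) then -1 else 0.

Fact ev_eps i j : ev_V R (ket [:: i; j]) = eps i j *: ket [::].
Proof.
rewrite ev_bas /eps; case: ifP => _; first by rewrite scale1r.
by case: ifP => _; rewrite ?scaleN1r ?scale0r.
Qed.

Fact ev_l i j k :
  tmap (ev_V R) I1 (ket [:: i; j; k]) = eps i j *: ket [:: k] :> tpow 1.
Proof.
rewrite -[[:: i; j; k]]/([:: i; j] ++ [:: k]) [LHS]tmap_bas // ev_eps.
by rewrite id_lfunE tmulZl tmul_bas.
Qed.

Fact ev_r i j k :
  tmap I1 (ev_V R) (ket [:: i; j; k]) = eps j k *: ket [:: i] :> tpow 1.
Proof.
rewrite -[[:: i; j; k]]/([:: i] ++ [:: j; k]) [LHS]tmap_bas // ev_eps.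
by rewrite id_lfunE tmulZr tmul_bas.
Qed.

Fact coev_r i : tmap I1 (coev_V R) (ket [:: i]) =
  ket [:: i; 1; 0] - ket [:: i; 0; 1] :> tpow 3.
Proof.
rewrite -[[:: i] in LHS]/([:: i] ++ [::]) [LHS]tmap_bas // coev_bas.
by rewrite id_lfunE tmulDr tmulNr !tmul_bas.
Qed.

Fact coev_l i : tmap (coev_V R) I1 (ket [:: i]) =
  ket [:: 1; 0; i] - ket [:: 0; 1; i] :> tpow 3.
Proof.
rewrite -[[:: i] in LHS]/([::] ++ [:: i]) [LHS]tmap_bas // coev_bas.
by rewrite id_lfunE tmulDl tmulNl !tmul_bas.
Qed.

Fact e1_l i j k : tmap (e1_V R) I1 (ket [:: i; j; k]) =
  (if i != j then - (ket [:: 0; 1; k] + ket [:: 1; 0; k]) else 0) :> tpow 3.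
Proof.
rewrite -[[:: i; j; k]]/([:: i; j] ++ [:: k]) [LHS]tmap_bas // e1_bas.
rewrite id_lfunE; case: ifP => _; last by rewrite tmul0l.
by rewrite tmulNl tmulDl !tmul_bas.
Qed.

Fact e1_r i j k : tmap I1 (e1_V R) (ket [:: i; j; k]) =
  (if j != k then - (ket [:: i; 0; 1] + ket [:: i; 1; 0]) else 0) :> tpow 3.
Proof.
rewrite -[[:: i; j; k]]/([:: i] ++ [:: j; k]) [LHS]tmap_bas // e1_bas.
rewrite id_lfunE; case: ifP => _; last by rewrite tmul0r.
by rewrite tmulNr tmulDr !tmul_bas.
Qed.

Fact ket1_ext (f g : 'End(tpow 1)) :
  (forall i, f (ket [:: i]) = g (ket [:: i])) -> f = g.
Proof.
move=> fg; apply: tpow_hom_ext => w; rewrite -[w]wlistK.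
by have := size_wlist w; case: (wlist w) => [|i [|]] //.
Qed.

Fact ket2_ext (W : vectType C) (f g : 'Hom(tpow 2, W)) :
  (forall i j, f (ket [:: i; j]) = g (ket [:: i; j])) -> f = g.
Proof.
move=> fg; apply: tpow_hom_ext => w; rewrite -[w]wlistK.
by have := size_wlist w; case: (wlist w) => [|i [|j [|]]] //.
Qed.

Fact V_loop : (ev_V R \o coev_V R)%VF = delta R *: \1%VF.
Proof.
apply: tpow_hom_ext => w; rewrite comp_lfunE -[w]wlistK (size0nil (size_wlist w)).
rewrite coev_bas linearB /= !ev_eps -scalerBl scale_lfunE id_lfunE.
by rewrite /eps /= /delta -opprD.
Qed.

Fact V_zigzagl : (tmap (ev_V R) I1 \o tmap I1 (coev_V R))%VF = \1%VF
  :> 'End(tpow 1).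
Proof.
apply: ket1_ext => i; apply: etrans (comp_lfunE _ _ _) _.
apply: etrans (congr1 _ (coev_r i)) _; rewrite id_lfunE.
apply: etrans (linearB _ _ _) _.
apply: etrans (congr2 (fun x y => x - y) (ev_l _ _ _) (ev_l _ _ _)) _.
rewrite /eps; case: (I2P i) => -> /=.
  by rewrite scale1r scale0r subr0.
by rewrite scaleN1r scale0r add0r opprK.
Qed.

Fact V_zigzagr : (tmap I1 (ev_V R) \o tmap (coev_V R) I1)%VF = \1%VF
  :> 'End(tpow 1).
Proof.
apply: ket1_ext => i; apply: etrans (comp_lfunE _ _ _) _.
apply: etrans (congr1 _ (coev_l i)) _; rewrite id_lfunE.
apply: etrans (linearB _ _ _) _.
apply: etrans (congr2 (fun x y => x - y) (ev_r _ _ _) (ev_r _ _ _)) _.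
rewrite /eps; case: (I2P i) => -> /=.
  by rewrite scaleN1r scale0r add0r opprK.
by rewrite scale1r scale0r subr0.
Qed.

Fact V_e1_right : (tmap I1 (ev_V R) \o
   (tmap (e1_V R) I1 \o tmap I1 (coev_V R)))%VF = \1%VF :> 'End(tpow 1).
Proof.
apply: ket1_ext => i; apply: etrans (comp_lfunE _ _ _) _.
apply: etrans (congr1 _ (comp_lfunE _ _ _)) _.
apply: etrans (congr1 _ (congr1 _ (coev_r i))) _; rewrite id_lfunE.
apply: etrans (congr1 _ (linearB _ _ _)) _.
apply: etrans (congr1 _ (congr2 (fun x y => x - y) (e1_l _ _ _) (e1_l _ _ _))) _.
case: (I2P i) => -> /=.
  rewrite subr0; apply: etrans (linearN _ _) _.
  apply: etrans (congr1 _ (linearD _ _ _)) _.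
  apply: etrans (congr1 _ (congr2 +%R (ev_r _ _ _) (ev_r _ _ _))) _.
  by rewrite /eps /= scale0r addr0 scaleN1r ?add0r ?opprK.
rewrite sub0r opprK; apply: etrans (linearD _ _ _) _.
apply: etrans (congr2 +%R (ev_r _ _ _) (ev_r _ _ _)) _.
by rewrite /eps /= scale0r scale1r ?add0r ?addr0.
Qed.

Fact V_e1_left : (tmap (ev_V R) I1 \o
   (tmap I1 (e1_V R) \o tmap (coev_V R) I1))%VF = \1%VF :> 'End(tpow 1).
Proof.
apply: ket1_ext => i; apply: etrans (comp_lfunE _ _ _) _.
apply: etrans (congr1 _ (comp_lfunE _ _ _)) _.
apply: etrans (congr1 _ (congr1 _ (coev_l i))) _; rewrite id_lfunE.
apply: etrans (congr1 _ (linearB _ _ _)) _.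
apply: etrans (congr1 _ (congr2 (fun x y => x - y) (e1_r _ _ _) (e1_r _ _ _))) _.
case: (I2P i) => -> /=.
  rewrite sub0r opprK; apply: etrans (linearD _ _ _) _.
  apply: etrans (congr2 +%R (ev_l _ _ _) (ev_l _ _ _)) _.
  by rewrite /eps /= scale0r scale1r ?add0r ?addr0.
rewrite subr0; apply: etrans (linearN _ _) _.
apply: etrans (congr1 _ (linearD _ _ _)) _.
apply: etrans (congr1 _ (congr2 +%R (ev_l _ _ _) (ev_l _ _ _))) _.
by rewrite /eps /= scale0r scaleN1r ?addr0 ?add0r ?opprK.
Qed.

Fact V_e1_coev : (e1_V R \o coev_V R)%VF = 0.
Proof.
apply: tpow_hom_ext => w; rewrite comp_lfunE -[w]wlistK coev_bas linearB /=.
by rewrite !e1_bas /= subrr zero_lfunE.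
Qed.

Fact V_ev_e1 : (ev_V R \o e1_V R)%VF = 0.
Proof.
apply: ket2_ext => i j; rewrite comp_lfunE e1_bas zero_lfunE.
case: ifP => _; last by rewrite linear0.
by rewrite linearN linearD /= !ev_eps /eps /= scale1r scaleN1r subrr oppr0.
Qed.

Fact V_e1_sq : (e1_V R \o e1_V R)%VF = delta R *: e1_V R.
Proof.
apply: ket2_ext => i j; rewrite comp_lfunE scale_lfunE e1_bas.
case: ifP => _; last by rewrite linear0 scaler0.
rewrite linearN linearD /= !e1_bas /=.
by rewrite /delta scalerN scaleNr !opprK scaler_nat mulr2n -opprD opprK.
Qed.

Lemma sem_deq k m n (f g : dia k m n) : deq f g -> sem f = sem g.
Proof.
elim=> {k m n f g}.
- by [].
- by move=> ? ? ? f g _ ->.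
- by move=> ? ? ? f g h _ -> _ ->.
- by move=> ? ? ? ? f f' g g' _ /= -> _ ->.
- by move=> ? ? ? f f' g g' _ /= -> _ ->.
- by move=> ? ? ? c f g _ /= ->.
- by move=> ? ? ? ? ? f f' g g' _ /= -> _ ->.
- by move=> * /=; rewrite addrA.
- by move=> * /=; rewrite addrC.
- by move=> * /=; rewrite add0r.
- by move=> * /=; rewrite scaleN1r addNr.
- by move=> * /=; rewrite scale1r.
- by move=> * /=; rewrite scalerA.
- by move=> * /=; rewrite scalerDr.
- by move=> * /=; rewrite scalerDl.
- by move=> * /=; rewrite comp_lfunA.
- by move=> * /=; rewrite comp_lfun1l.
- by move=> * /=; rewrite comp_lfun1r.
- by move=> * /=; rewrite comp_lfunDl.
- by move=> * /=; rewrite comp_lfunDr.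
- by move=> * /=; rewrite -comp_lfunZl.
- by move=> * /=; rewrite -comp_lfunZr.
- by move=> * /=; rewrite tmapDl.
- by move=> * /=; rewrite tmapDr.
- by move=> * /=; rewrite tmapZl.
- by move=> * /=; rewrite tmapZr.
- by move=> * /=; rewrite tmap1.
- by move=> * /=; rewrite tmap_comp.
- move=> k a b c d p q f g h; apply: seq_ext => s t.
  move=> /size_catP[s12 [s3 [-> /size_catP[s1 [s2 [-> H1 H2]]] H3]]].
  move=> /size_catP[t12 [t3 [-> /size_catP[t1 [t2 [-> K1 K2]]] K3]]].
  rewrite sem_dcast /=; transitivity ((sem f (ket s1) (wseq b t1) : C) *
    (sem g (ket s2) (wseq d t2) * sem h (ket s3) (wseq q t3))).
    rewrite -!catA; apply: etrans (tmapE _ _ H1 _ K1 _) _.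
    - by rewrite size_cat H2 H3.
    - by rewrite size_cat K2 K3.
    by congr (_ * _); apply: tmapE.
  rewrite mulrA; apply: esym; apply: etrans (tmapE _ _ _ H3 _ K3) _.
  - by rewrite size_cat H1 H2.
  - by rewrite size_cat K1 K2.
  by congr (_ * _); apply: tmapE.
- move=> k a b f; apply: seq_ext => s t Hs Ht.
  rewrite sem_dcast /= -{1}[s]cats0 -{1}[t]cats0 tmapE // id_lfunE ffunE.
  by rewrite eqxx mulr1.
- by move=> * /=; rewrite tmapl1.
- exact: V_loop.
- exact: V_zigzagl.
- exact: V_zigzagr.
- by rewrite !sem_Comp !sem_undec; exact: V_e1_right.
- by rewrite 2!sem_Comp sem_pull !sem_undec; exact: V_e1_left.
- by rewrite !sem_Comp sem_undec; exact: V_e1_coev.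
- by rewrite !sem_Comp sem_undec; exact: V_ev_e1.
- exact: V_e1_sq.
- move=> a b c d f g; rewrite (sem_Comp (Tens f _)) (sem_Comp (pull b g)).
  rewrite !sem_pull /= -!tmap_comp.
  by rewrite !comp_lfun1l !comp_lfun1r.
Qed.
End Functor.

Section Equivariance.
Variables (R : realType) (theta : R).
Local Notation C := R[i].
Local Notation dia := (dia R).
Local Notation tpow := (@tpow R).
Local Notation Dic := (Dic theta).
Local Notation ket s := (tbas R (wseq _ s)).
Implicit Types (g h : 'M[C]_2) (i j : 'I_2).

Fact tact_tmap a b g : tact (a + b) g = tmap (tact a g) (tact b g).
Proof.
apply: seq_ext => s t.
move=> /size_catP[s1 [s2 [-> H1 H2]]] /size_catP[t1 [t2 [-> K1 K2]]].
apply: esym; apply: etrans (tmapE _ _ H1 H2 K1 K2) _; rewrite !tact_tbas !ffunE.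
rewrite big_split_ord /=; congr (_ * _); apply: eq_bigr => i _;
  rewrite !ffunE /= !nth_cat H1 K1.
  by rewrite !ltn_ord.
by rewrite !ltnNge !leq_addr /= !addKn.
Qed.

Fact tact0 g : tact 0 g = \1%VF.
Proof.
apply: seq_ext => s t /size0nil -> /size0nil ->.
by rewrite tact_tbas id_lfunE !ffunE big_ord0 eqxx.
Qed.

Fact tact_ket1 g i :
  tact 1 g (ket [:: i]) = g 0 i *: ket [:: 0] + g 1 i *: ket [:: 1] :> tpow 1.
Proof.
apply/ffunP => w.
have EZ c (u : tpow 1) : (c *: u) w = c * u w by rewrite ffunE.
have ED (u v : tpow 1) : (u + v) w = u w + v w by rewrite ffunE.
have EK k : (ket [:: k] : tpow 1) w = (w 0 == k)%:R.
  rewrite ffunE; congr (nat_of_bool _)%:R; apply/eqP/eqP => [->|<-].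
    by rewrite ffunE.
  by apply/ffunP => l; rewrite ffunE ord1.
apply: etrans (congr1 (fun u : tpow 1 => u w) (tact_tbas _ _)) _.
apply: etrans (etrans (ffunE _ _) (big_ord1 _ _)) _.
have -> : wseq 1 [:: i] 0 = i by rewrite ffunE.
apply: esym; apply: etrans (ED _ _) _.
apply: etrans (congr2 +%R (EZ _ _) (EZ _ _)) _; rewrite !EK.
by case: (I2P (w 0)) => ->; rewrite /= ?mulr1 ?mulr0 ?addr0 ?add0r.
Qed.

Fact tact_ket2 g i j : tact 2 g (ket [:: i; j]) =
  tmul (tact 1 g (ket [:: i])) (tact 1 g (ket [:: j])).
Proof.
rewrite -[2%N]/(1 + 1)%N (tact_tmap 1 1).
by rewrite -[[:: i; j]]/([:: i] ++ [:: j]) tmap_bas.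
Qed.

Fact tmul_lin2 a b (z z' y y' : C) (u u' : tpow a) (v v' : tpow b) :
  tmul (z *: u + z' *: u') (y *: v + y' *: v') =
  (z * y) *: tmul u v + (z * y') *: tmul u v' +
  ((z' * y) *: tmul u' v + (z' * y') *: tmul u' v').
Proof. by rewrite tmulDl !tmulDr !tmulZl !tmulZr !scalerA. Qed.

Fact tact_ket2E g i j : tact 2 g (ket [:: i; j]) =
  (g 0 i * g 0 j) *: ket [:: 0; 0] + (g 0 i * g 1 j) *: ket [:: 0; 1] +
  ((g 1 i * g 0 j) *: ket [:: 1; 0] + (g 1 i * g 1 j) *: ket [:: 1; 1])
  :> tpow 2.
Proof.
apply: etrans (tact_ket2 _ _ _) _.
apply: etrans (congr2 (@tmul R 1 1) (tact_ket1 _ _) (tact_ket1 _ _)) _.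
apply: etrans (@tmul_lin2 1 1 _ _ _ _ _ _ _ _) _.
have E k l : @tmul R 1 1 (ket [:: k]) (ket [:: l]) = ket [:: k; l] :> tpow 2.
  exact: (@tmul_bas R 1 1 [:: k] [:: l]).
by apply: congr2; apply: congr2; exact: (congr1 _ (E _ _)).
Qed.

Fact lin4 (W : vectType C) n (L : 'Hom(tpow n, W)) (z1 z2 z3 z4 : C)
    (u1 u2 u3 u4 : tpow n) :
  L (z1 *: u1 + z2 *: u2 + (z3 *: u3 + z4 *: u4)) =
  z1 *: L u1 + z2 *: L u2 + (z3 *: L u3 + z4 *: L u4).
Proof. by rewrite !linearD !linearZ. Qed.

Fact sum4 n (z1 z2 z3 z4 y1 y2 y3 y4 : C) (u1 u2 u3 u4 : tpow n) :
  (z1 *: u1 + z2 *: u2 + (z3 *: u3 + z4 *: u4)) +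
  (y1 *: u1 + y2 *: u2 + (y3 *: u3 + y4 *: u4)) =
  (z1 + y1) *: u1 + (z2 + y2) *: u2 + ((z3 + y3) *: u3 + (z4 + y4) *: u4).
Proof. by rewrite !scalerDl addrACA; congr (_ + _); rewrite addrACA. Qed.

Fact opp4 n (z1 z2 z3 z4 : C) (u1 u2 u3 u4 : tpow n) :
  - (z1 *: u1 + z2 *: u2 + (z3 *: u3 + z4 *: u4)) =
  (- z1) *: u1 + (- z2) *: u2 + ((- z3) *: u3 + (- z4) *: u4).
Proof. by rewrite !opprD !scaleNr. Qed.

Section ScaleAlgebra.
Variables (W : lmodType C) (z1 z2 z3 z4 y1 y2 y3 y4 : C) (u u1 u2 u3 u4 : W).

Fact lin4_eps :
  z1 *: (eps R 0 0 *: u) + z2 *: (eps R 0 1 *: u) +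
  (z3 *: (eps R 1 0 *: u) + z4 *: (eps R 1 1 *: u)) = (z2 - z3) *: u.
Proof.
rewrite !scalerA -!scalerDl /eps /=; congr (_ *: _).
by rewrite !mulr0 add0r addr0 mulr1 mulrN1.
Qed.

Fact lin4_antisym : z1 + y1 = 0 -> z4 + y4 = 0 ->
    z2 + y2 = - 1 -> z3 + y3 = 1 ->
  (z1 + y1) *: u1 + (z2 + y2) *: u2 + ((z3 + y3) *: u3 + (z4 + y4) *: u4) =
  u3 - u2.
Proof.
by move=> -> -> -> ->; rewrite !scale0r add0r addr0 scale1r scaleN1r addrC.
Qed.

Fact lin4_sym0 :
  z1 *: 0 + z2 *: u + (z3 *: u + z4 *: 0) = (z2 + z3) *: u.
Proof. by rewrite !scaler0 add0r addr0 scalerDl. Qed.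

Fact lin4_sym p : z1 + y1 = 0 -> z4 + y4 = 0 -> z2 + y2 = p -> z3 + y3 = p ->
  (z1 + y1) *: u1 + (z2 + y2) *: u2 + ((z3 + y3) *: u3 + (z4 + y4) *: u4) =
  p *: (u2 + u3).
Proof. by move=> -> -> -> ->; rewrite !scale0r add0r addr0 scalerDr. Qed.

End ScaleAlgebra.

Fact det22 g : \det g = g 0 0 * g 1 1 - g 1 0 * g 0 1.
Proof.
rewrite (expand_det_col _ 0) !big_ord_recl big_ord0 addr0 /cofactor.
rewrite !det_mx11 !mxE /=.
have -> : lift (0 : 'I_2) (0 : 'I_1) = 1 by apply: val_inj.
have -> : lift (1 : 'I_2) (0 : 'I_1) = 0 by apply: val_inj.
by rewrite expr0 mul1r expr1 mulN1r mulrN.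
Qed.

Fact ev_tact g : \det g = 1 ->
  (ev_V R \o tact 2 g)%VF = (tact 0 g \o ev_V R)%VF.
Proof.
rewrite det22 tact0 comp_lfun1l => Dg; apply: ket2_ext => i j.
apply: etrans (comp_lfunE _ _ _) _.
apply: etrans (congr1 _ (tact_ket2E _ _ _)) _.
apply: etrans (lin4 _ _ _ _ _ _ _ _ _) _.
apply: etrans (congr2 +%R
  (congr2 +%R (congr1 _ (ev_eps _ _ _)) (congr1 _ (ev_eps _ _ _)))
  (congr2 +%R (congr1 _ (ev_eps _ _ _)) (congr1 _ (ev_eps _ _ _)))) _.
apply: etrans (lin4_eps _ _ _ _ _) (etrans _ (esym (ev_eps _ _ _))).
congr (_ *: _); rewrite /eps.
case: (I2P i) => ->; case: (I2P j) => -> /=.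
- by rewrite mulrC subrr.
- by [].
- by rewrite -[RHS](congr1 -%R Dg) opprB mulrC [g 0 0 * _]mulrC.
- by rewrite mulrC subrr.
Qed.

Fact coev_tact g : \det g = 1 ->
  (coev_V R \o tact 0 g)%VF = (tact 2 g \o coev_V R)%VF.
Proof.
rewrite det22 tact0 comp_lfun1r => Dg; apply: tpow_hom_ext => w.
rewrite -[w]wlistK; apply: esym; apply: etrans (comp_lfunE _ _ _) _.
apply: etrans (congr1 _ (coev_bas _ _)) _.
apply: etrans (linearB _ _ _) _.
apply: etrans (congr2 (fun x y => x - y) (tact_ket2E _ _ _) (tact_ket2E _ _ _)) _.
apply: etrans (congr1 _ (opp4 _ _ _ _ _ _ _ _)) _.
apply: etrans (sum4 _ _ _ _ _ _ _ _ _ _ _ _) _.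
apply: etrans (lin4_antisym _ _ _ _ _ _ _ _) (esym (coev_bas _ _)).
- by rewrite mulrC subrr.
- by rewrite mulrC subrr.
- by rewrite -[RHS](congr1 -%R Dg) opprB mulrC.
- by rewrite mulrC.
Qed.

Fact e1_tact g :
  g 0 0 * g 1 0 = 0 -> g 0 1 * g 1 1 = 0 ->
  g 0 0 * g 0 1 = 0 -> g 1 0 * g 1 1 = 0 ->
  (e1_V R \o tact 2 g)%VF = (tact 2 g \o e1_V R)%VF.
Proof.
move=> c0 c1 r0 r1; apply: ket2_ext => i j.
apply: etrans (comp_lfunE _ _ _) _; apply: esym.
apply: etrans (comp_lfunE _ _ _) _; apply: esym.
apply: etrans (congr1 _ (tact_ket2E _ _ _)) _.
apply: etrans (lin4 _ _ _ _ _ _ _ _ _) _.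
apply: etrans (congr2 +%R
  (congr2 +%R (congr1 _ (e1_bas _ _ _)) (congr1 _ (e1_bas _ _ _)))
  (congr2 +%R (congr1 _ (e1_bas _ _ _)) (congr1 _ (e1_bas _ _ _)))) _.
apply: etrans (lin4_sym0 _ _ _ _ _) _.
apply: esym; apply: etrans (congr1 _ (e1_bas _ _ _)) _; apply: esym.
case: (eqVneq i j) => [<-|nij] /=.
  apply: etrans (esym (linear0 _)); rewrite (_ : _ + _ = 0) ?scale0r //.
  by rewrite [g 1 i * _]mulrC; case: (I2P i) => ->; rewrite ?c0 ?c1 addr0.
apply: esym; apply: etrans (linearN _ _) _.
apply: etrans (congr1 _ (linearD _ _ _)) _.
apply: etrans (congr1 _ (congr2 +%R (tact_ket2E _ _ _) (tact_ket2E _ _ _))) _.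
apply: etrans (congr1 _ (sum4 _ _ _ _ _ _ _ _ _ _ _ _)) _.
apply: etrans (congr1 _ (lin4_sym (p := g 0 i * g 1 j + g 1 i * g 0 j)
  _ _ _ _ _ _ _ _)) (esym (scalerN _ _)).
- by rewrite [g 0 1 * _]mulrC r0 addr0.
- by rewrite [g 1 1 * _]mulrC r1 addr0.
- move: nij; case: (I2P i) => ->; case: (I2P j) => -> // _.
    by congr (_ + _); rewrite mulrC.
  by rewrite addrC; congr (_ + _); rewrite mulrC.
- move: nij; case: (I2P i) => ->; case: (I2P j) => -> // _.
    by rewrite addrC; congr (_ + _); rewrite mulrC.
  by congr (_ + _); rewrite mulrC.
Qed.

Local Notation cE := (mul0r, mulr0, mul1r, mulr1, mulN1r, mulrN1, mulrN, mulNr,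
  subr0, sub0r, addr0, add0r, oppr0, opprK) (only parsing).

Fact Dic_SU2 g : Dic g -> SU2 g.
Proof.
elim=> {g}.
- split; last by rewrite det22 !mxE /= mul0r mul1r sub0r opprK.
  apply/matrixP => i j; rewrite !mxE !big_ord_recl big_ord0 !mxE.
  by case: (I2P i) => ->; case: (I2P j) => ->; apply/eqP;
     rewrite eq_complex /= !cE !eqxx.
- have cs : sin theta * sin theta + cos theta * cos theta = 1.
    by rewrite -!expr2 addrC cos2Dsin2.
  split; last first.
    apply/eqP; rewrite det22 !mxE eq_complex /= !cE [_ * sin _ ]mulrC.
    by rewrite addrC cs mulrC addNr !eqxx.
  apply/matrixP => i j; rewrite !mxE !big_ord_recl big_ord0 !mxE.
  by case: (I2P i) => ->; case: (I2P j) => ->; apply/eqP;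
     rewrite eq_complex /= !cE ?[cos _ * cos _ + _]addrC ?cs
       ?[cos _ * sin _]mulrC ?addNr ?subrr !eqxx.
- by rewrite /SU2 map_mx1 trmx1 mulmx1 det1.
- move=> g h _ [Ug Dg] _ [Uh Dh]; split; last first.
    by rewrite det_mulmx Dg Dh mulr1.
  rewrite map_mxM trmx_mul mulmxA -[g *m h *m _]mulmxA Uh mulmx1; exact: Ug.
- move=> g _ [Ug Dg]; have gU : g \in unitmx by rewrite unitmxE Dg unitr1.
  split; last by rewrite det_inv Dg invr1.
  have -> : (map_mx (@conjc R) g^-1)^T = g.
    rewrite [map_mx _ _]map_invmx trmx_inv.
    by rewrite -[LHS]mul1mx -Ug -mulmxA mulmxV ?mulmx1 // unitmx_tr map_unitmx.
  exact: mulVmx.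
Qed.

Fact commute_Dic m n (f : 'Hom(tpow m, tpow n)) :
  (f \o tact m (dic_x R) = tact n (dic_x R) \o f)%VF ->
  (f \o tact m (dic_a theta) = tact n (dic_a theta) \o f)%VF ->
  f \in @equivariant R theta (Vpow theta m) (Vpow theta n).
Proof.
move=> fx fa.
suff H g : Dic g -> (f \o tact m g = tact n g \o f)%VF by apply/asboolP.
elim=> {g}; [exact: fx | exact: fa | | | ].
- by rewrite !tact1 comp_lfun1l comp_lfun1r.
- move=> g h _ fg _ fh; rewrite !tactM.
  by rewrite comp_lfunA fg -comp_lfunA fh comp_lfunA.
- move=> g Dg fg; have [_ Dg1] := Dic_SU2 Dg.
  have gU : g \is a GRing.unit by rewrite [_ \is a _]unitmxE Dg1 unitr1.
  have gVg k : (tact k g^-1 \o tact k g = \1)%VF.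
    by rewrite -tactM mulVr // tact1.
  have ggV k : (tact k g \o tact k g^-1 = \1)%VF.
    by rewrite -tactM mulrV // tact1.
  rewrite -[LHS]comp_lfun1l -(gVg n) -comp_lfunA; congr (_ \o _)%VF.
  by rewrite comp_lfunA -fg -comp_lfunA ggV comp_lfun1r.
Qed.

Fact sem_equivariant k m n (f : dia k m n) :
  sem f \in @equivariant R theta (Vpow theta m) (Vpow theta n).
Proof.
elim: f => {k m n} /=.
- by move=> _ n; apply: equivariant_id.
- move=> k m n p f Hf g Hg.
  exact: (equivariant_comp (Intertwiner Hf) (Intertwiner Hg)).
- by move=> *; apply: rpred0.
- by move=> *; apply: rpredD.
- by move=> *; apply: rpredZ.
- move=> k a b c d f /asboolP /= Hf g /asboolP /= Hg; apply/asboolP => h Dh /=.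
  apply: etrans (congr1 (comp_lfun _) (tact_tmap a c h)) _.
  apply: etrans (esym (tmap_comp _ _ _ _)) _.
  apply: etrans (congr2 (@tmap R a b c d) (Hf h Dh) (Hg h Dh)) _.
  apply: etrans (tmap_comp _ _ _ _) _.
  exact: (congr1 (fun x => x \o tmap (sem f) (sem g))%VF (esym (tact_tmap b d h))).
- apply/asboolP => g Dg /=; have [_ D1] := Dic_SU2 Dg; exact: ev_tact.
- apply/asboolP => g Dg /=; have [_ D1] := Dic_SU2 Dg; exact: coev_tact.
- by apply: commute_Dic; apply: e1_tact; rewrite !mxE /= ?mul0r ?mulr0.
Qed.

End Equivariance.

Section TheFunctor.
Variables (R : realType) (theta : R).
Local Notation C := R[i].

(* The monoidal subcategory generated by V: its objects are the V^{(x) n}. *)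
Definition TensorV : lincat C :=
  full_subcat (A := RepDic theta) (fun n : nat => Vpow theta n).

Definition F_mor m n (u : DHom R DiTL m n) :
    intertwiner (Vpow theta m) (Vpow theta n) :=
  Intertwiner (sem_equivariant theta (repr u)).

Lemma F_cls m n (f : dia R DiTL m n) : ihom (F_mor (cls f)) = sem f.
Proof. exact/sem_deq/reprP. Qed.

Fact F_linear m n : linear (@F_mor m n).
Proof.
move=> c u v; apply: val_inj; rewrite -[u]clsK -[v]clsK cls_lin.
apply: etrans (F_cls _) _.
exact: (congr2 +%R (congr1 ( *:%R c) (esym (F_cls _))) (esym (F_cls _))).
Qed.

Fact F_id n : F_mor (idm (dia_cat R DiTL) n) = idm TensorV n.
Proof. by apply: val_inj; rewrite [LHS]F_cls. Qed.

Fact F_comp m n p (u : DHom R DiTL n p) (v : DHom R DiTL m n) :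
  F_mor (ccomp u v) =
  compm (F_mor u : hom TensorV n p) (F_mor v : hom TensorV m n).
Proof.
apply: val_inj; rewrite -[u]clsK -[v]clsK ccompE.
apply: etrans (F_cls _) _.
exact: (congr2 (@comp_lfun _ _ _ _) (esym (F_cls _)) (esym (F_cls _))).
Qed.

Definition DiTL_functor : linfunctor (dia_cat R DiTL) TensorV :=
  @LinFunctor C (dia_cat R DiTL) TensorV id F_mor F_linear F_id F_comp.

(* DiTL_functor is a ribbon functor with the prescribed values. *)
Lemma F_juxt a b c d (f : dia R DiTL a b) (g : dia R DiTL c d) :
  ihom (F_mor (cls (juxt f g))) =
  tmap (ihom (F_mor (cls f))) (ihom (F_mor (cls g))).
Proof. by rewrite !F_cls sem_juxt. Qed.

Lemma F_crossing a b (u : tpow R a) (v : tpow R b) :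
  ihom (F_mor (cls (undec (crossing R a b)))) (tmul u v) = tmul v u.
Proof. by rewrite F_cls sem_undec sem_crossing. Qed.

Lemma F_ev : ihom (F_mor (cls (undec (Ev R)))) = ev_V R.
Proof. by rewrite F_cls sem_undec. Qed.

Lemma F_coev : ihom (F_mor (cls (undec (Coev R)))) = coev_V R.
Proof. by rewrite F_cls sem_undec. Qed.

Lemma F_E1 : ihom (F_mor (cls (E1 R))) = e1_V R.
Proof. by rewrite F_cls. Qed.

End TheFunctor.

(* Main.v *)
(* Dic_oo-intertwiners behave like type D Temperley-Lieb diagrams: the tensor
   powers of V decompose along paths in the graph with vertices the trivial
   representation, the sign character and the two-dimensional representations
   W_k spanned by the (k+1)st powers of v_1 and v_2, an edge meaning that a
   representation occurs in the tensor product of V with the other one.  The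
   same decomposition holds in DiTL: the vertices are the idempotents id_0,
   -e/2 and a Jones-Wenzl tower Pi_k starting from Pi_1 = 1 + (e + coev ev)/2,
   where e is the decorated cup-cap, and each edge is given by a pair of
   mutually dual morphisms.  The only identity not following at once from
   relations (3), (5) and (6) is e_1 (coev ev)_2 e_1 = e_1 on three strands,
   which expresses that the sign character tensored with V is V; it is the
   interchange law applied to two copies of e, with one cup inserted.
   Checking the generators then shows that every morphism of DiTL is diagonal
   with respect to paths, so morphisms 0 -> n are combinations of paths ending
   at the trivial vertex.  The functor is faithful on them because the two
   halves of a path compose to the identity, and full because no other vertex
   has invariants (this uses that theta / pi is irrational).  Rotation of
   strands reduces all other Hom-spaces to these. *)
Require Import Defs.
From HB Require Import structures.
From mathcomp Require Import all_boot all_order all_algebra.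
From mathcomp Require Import complex ring.
From mathcomp Require Import boolp reals trigo.

Set Implicit Arguments.
Unset Strict Implicit.
Unset Printing Implicit Defensive.

Import Order.TTheory GRing.Theory Num.Theory.
Local Open Scope ring_scope.

(** * Diagram calculus *)

Section Calculus.
Variable R : realType.
Local Notation C := R[i].
Local Notation DH := (DHom R DiTL).

Definition dia_id k n : DHom R k n n := cls (Id R k n).
Definition ctens k a b c d (u : DHom R k a b) (v : DHom R TL c d) :
  DHom R k (a + c) (b + d) := cls (Tens (repr u) (repr v)).

Local Infix "**" := (@ccomp R _ _ _ _) (at level 40, left associativity).

Lemma cls_Id k n : cls (Id R k n) = dia_id k n.
Proof. by []. Qed.

Lemma cls_Zero k m n : cls (Zero R k m n) = 0.
Proof. by []. Qed.

Lemma cls_Add k m n (f g : dia R k m n) : cls (Add f g) = cls f + cls g.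
Proof. by rewrite [RHS]caddE. Qed.

Lemma cls_Scale k m n z (f : dia R k m n) : cls (Scale z f) = z *: cls f.
Proof. by rewrite [RHS]cscaleE. Qed.

Lemma ctensE k a b c d (f : dia R k a b) (g : dia R TL c d) :
  ctens (cls f) (cls g) = cls (Tens f g).
Proof. by apply/clsP; apply: deq_Tens; apply: reprP. Qed.

Lemma ccompA k m n p q (f : DHom R k p q) (g : DHom R k n p)
    (h : DHom R k m n) :
  f ** (g ** h) = f ** g ** h.
Proof. exact: (@compmA _ (dia_cat R k)). Qed.

Lemma ccomp1l k m n (f : DHom R k m n) : dia_id k n ** f = f.
Proof. exact: (@comp1m _ (dia_cat R k)). Qed.

Lemma ccomp1r k m n (f : DHom R k m n) : f ** dia_id k m = f.
Proof. exact: (@compm1 _ (dia_cat R k)). Qed.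

Section Bilinear.
Variables (k : kind) (m n p : nat).
Implicit Types (f : DHom R k n p) (g : DHom R k m n) (a : C).

Fact ccompPl g : linear (fun f => f ** g).
Proof. exact: (@comp_linl _ (dia_cat R k)). Qed.
Fact ccompPr f : linear (fun g => f ** g).
Proof. exact: (@comp_linr _ (dia_cat R k)). Qed.

Let lcomp g : {linear DHom R k n p -> DHom R k m p} :=
  HB.pack (fun f => f ** g) (GRing.isLinear.Build _ _ _ _ _ (ccompPl g)).
Let rcomp f : {linear DHom R k m n -> DHom R k m p} :=
  HB.pack (fun g => f ** g) (GRing.isLinear.Build _ _ _ _ _ (ccompPr f)).

Lemma ccompDl g f f' : (f + f') ** g = f ** g + f' ** g.
Proof. exact: (linearD (lcomp g)). Qed.
Lemma ccompDr f g g' : f ** (g + g') = f ** g + f ** g'.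
Proof. exact: (linearD (rcomp f)). Qed.
Lemma ccompZl a f g : (a *: f) ** g = a *: (f ** g).
Proof. exact: (linearZ_LR (lcomp g)). Qed.
Lemma ccompZr a f g : f ** (a *: g) = a *: (f ** g).
Proof. exact: (linearZ_LR (rcomp f)). Qed.
Lemma ccomp0l g : (0 : DHom R k n p) ** g = 0.
Proof. exact: (linear0 (lcomp g)). Qed.
Lemma ccomp0r f : f ** (0 : DHom R k m n) = 0.
Proof. exact: (linear0 (rcomp f)). Qed.
Lemma ccompNl f g : (- f) ** g = - (f ** g).
Proof. exact: (linearN (lcomp g)). Qed.
Lemma ccompNr f g : f ** (- g) = - (f ** g).
Proof. exact: (linearN (rcomp f)). Qed.
Lemma ccomp_suml I (r : seq I) (F : I -> DHom R k n p) g :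
  (\sum_(i <- r) F i) ** g = \sum_(i <- r) F i ** g.
Proof. exact: (linear_sum (lcomp g)). Qed.
Lemma ccomp_sumr I (r : seq I) f (F : I -> DHom R k m n) :
  f ** (\sum_(i <- r) F i) = \sum_(i <- r) f ** F i.
Proof. exact: (linear_sum (rcomp f)). Qed.
End Bilinear.

(** * Hom-spaces up to equality of the numbers of points *)

Definition hcast k m n m' n' (em : m = m') (en : n = n') (u : DHom R k m n) :
    DHom R k m' n' :=
  ecast q (DHom R k m' q) en (ecast p (DHom R k p n) em u).

Lemma hcast_id k m n (em : m = m) (en : n = n) (u : DHom R k m n) :
  hcast em en u = u.
Proof. by rewrite (eq_irrelevance em erefl) (eq_irrelevance en erefl). Qed.

Lemma hcast_comp k m n p m' n' p' (em : m = m') (en : n = n') (ep : p = p')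
    (u : DHom R k n p) (v : DHom R k m n) :
  hcast em ep (u ** v) = hcast en ep u ** hcast em en v.
Proof. by case: _ / em; case: _ / en; case: _ / ep. Qed.

Lemma hcast_linear k m n m' n' (em : m = m') (en : n = n') :
  linear (@hcast k m n m' n' em en).
Proof. by move=> a u v; case: _ / em; case: _ / en. Qed.

Lemma hcast_cls k m n m' n' (em : m = m') (en : n = n') (f : dia R k m n) :
  hcast em en (cls f) = cls (dcast em en f).
Proof. by case: _ / em; case: _ / en. Qed.

(** Equalities such as [a + 1 = a.+1] do not hold by conversion, so diagrams are compared with the
    casts quantified existentially. Proofs of equality in [nat] are unique, hence nothing is lost
    when the types already agree. *)
Definition heq k m n m' n' (u : DHom R k m n) (v : DHom R k m' n') : Prop :=
  exists em en, hcast em en u = v.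

Lemma heqP k m n (u v : DHom R k m n) : heq u v -> u = v.
Proof. by case=> em [en <-]; rewrite hcast_id. Qed.

Lemma heq_refl k m n (u : DHom R k m n) : heq u u.
Proof. by exists erefl, erefl. Qed.

Lemma heq_sym k m n m' n' (u : DHom R k m n) (v : DHom R k m' n') :
  heq u v -> heq v u.
Proof.
case=> em [en]; case: _ / em v => v; case: _ / en v => v <-; exact: heq_refl.
Qed.

Lemma heq_trans k m n m' n' m'' n'' (u : DHom R k m n) (v : DHom R k m' n')
    (w : DHom R k m'' n'') : heq u v -> heq v w -> heq u w.
Proof.
by case=> em [en]; case: _ / em v => v; case: _ / en v => v <-.
Qed.

Lemma heq_cast k m n m' n' (em : m = m') (en : n = n') (u : DHom R k m n) :
  heq (hcast em en u) u.
Proof. by case: _ / em; case: _ / en; exact: heq_refl. Qed.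

Lemma heq_tens k a b c d a' b' c' d' (u : DHom R k a b) (v : DHom R TL c d)
    (u' : DHom R k a' b') (v' : DHom R TL c' d') :
  heq u u' -> heq v v' -> heq (ctens u v) (ctens u' v').
Proof.
case=> ea [eb]; case: _ / ea u' => u'; case: _ / eb u' => u' <-.
case=> ec [ed]; case: _ / ec v' => v'; case: _ / ed v' => v' <-.
exact: heq_refl.
Qed.

Lemma heq_comp k m n p m' n' p' (u : DHom R k n p) (v : DHom R k m n)
    (u' : DHom R k n' p') (v' : DHom R k m' n') :
  heq u u' -> heq v v' -> heq (u ** v) (u' ** v').
Proof.
case=> en [ep]; case: _ / en u' v' => u' v'; case: _ / ep u' => u' <-.
case=> em [en]; case: _ / em v' => v'.
by rewrite (eq_irrelevance en erefl) => <-; exact: heq_refl.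
Qed.

Lemma ctensA k a b c d p q (u : DHom R k a b) (v : DHom R TL c d)
    (w : DHom R TL p q) : heq (ctens u (ctens v w)) (ctens (ctens u v) w).
Proof.
exists (addnA a c p), (addnA b d q).
rewrite -[u]clsK -[v]clsK -[w]clsK !ctensE hcast_cls.
by apply/clsP; apply: deq_tensA.
Qed.

Lemma ctens0r k a b (u : DHom R k a b) : heq (ctens u (dia_id TL 0)) u.
Proof.
exists (addn0 a), (addn0 b); rewrite -[u]clsK ctensE hcast_cls.
by apply/clsP; apply: deq_tensr1.
Qed.

Lemma ctens11 k a b : ctens (dia_id k a) (dia_id TL b) = dia_id k (a + b).
Proof. by rewrite ctensE; apply/clsP; apply: deq_tens1. Qed.

Lemma ctens_comp k a b c a' b' c' (f : DHom R k b c) (g : DHom R k a b)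
    (f' : DHom R TL b' c') (g' : DHom R TL a' b') :
  ctens (f ** g) (f' ** g') = ctens f f' ** ctens g g'.
Proof.
rewrite -[f]clsK -[g]clsK -[f']clsK -[g']clsK (ccompE (repr f) (repr g)).
rewrite (ccompE (repr f')) !ctensE ccompE.
by apply/clsP; apply: deq_tens_comp.
Qed.

Lemma ctens_linl k a b c d (v : DHom R TL c d) :
  linear (fun u : DHom R k a b => ctens u v).
Proof.
move=> z u u'; rewrite -[u]clsK -[u']clsK -[v]clsK cls_lin !ctensE cls_lin.
apply/clsP; apply: deq_trans (deq_tensDl _ _ _) _.
by apply: deq_Add (deq_refl _); apply: deq_tensZl.
Qed.

Lemma ctens_linr k a b c d (u : DHom R k a b) :
  linear (fun v : DHom R TL c d => ctens u v).
Proof.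
move=> z v v'; rewrite -[u]clsK -[v]clsK -[v']clsK cls_lin !ctensE cls_lin.
apply/clsP; apply: deq_trans (deq_tensDr _ _ _) _.
by apply: deq_Add (deq_refl _); apply: deq_tensZr.
Qed.

(* The right action of a strand, with the new point counted by [.+1] so that
   iterating it needs no casts. *)
Definition strand m n (u : DH m n) : DH m.+1 n.+1 :=
  hcast (addn1 m) (addn1 n) (ctens u (dia_id TL 1)).

(* The action of v : c -> d on the object a; points of v are counted first. *)
Definition act a c d (v : DHom R TL c d) : DH (c + a) (d + a) :=
  hcast (addnC a c) (addnC a d) (ctens (dia_id DiTL a) v).

Fixpoint strands c m n (u : DH m n) : DH (c + m) (c + n) :=
  if c is c'.+1 then strand (strands c' u) else u.

Fact strand_linear m n : linear (@strand m n).
Proof. by move=> a u v; rewrite /strand ctens_linl hcast_linear. Qed.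
HB.instance Definition _ m n :=
  GRing.isLinear.Build C (DH m n) (DH m.+1 n.+1) _ (@strand m n)
    (@strand_linear m n).

Lemma strandD m n (u v : DH m n) : strand (u + v) = strand u + strand v.
Proof. exact: linearD. Qed.
Lemma strandZ m n a (u : DH m n) : strand (a *: u) = a *: strand u.
Proof. exact: linearZ. Qed.
Lemma strandN m n (u : DH m n) : strand (- u) = - strand u.
Proof. exact: linearN. Qed.
Lemma strand0 m n : strand (0 : DH m n) = 0.
Proof. exact: linear0. Qed.

Lemma strand1 n : strand (dia_id DiTL n) = dia_id DiTL n.+1.
Proof.
rewrite /strand ctens11; apply: heqP.
by apply: heq_trans (heq_cast _ _ _) _; rewrite addn1; exact: heq_refl.
Qed.

Lemma strand_comp m n p (u : DH n p) (v : DH m n) :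
  strand (u ** v) = strand u ** strand v.
Proof.
rewrite /strand -[dia_id TL 1]ccomp1l ctens_comp (hcast_comp _ (addn1 n)).
by rewrite ccomp1l.
Qed.

Lemma strands_heq c m n (u : DH m n) :
  heq (strands c u) (ctens u (dia_id TL c)).
Proof.
elim: c => [|c IH] /=; first by apply: heq_sym; exact: ctens0r.
apply: heq_trans (heq_cast _ _ _) _.
apply: heq_trans (heq_tens IH (heq_refl _)) _.
apply: heq_trans (heq_sym (ctensA _ _ _)) _; rewrite ctens11 addn1.
exact: heq_refl.
Qed.

Lemma act_heq a c d (v : DHom R TL c d) :
  heq (act a v) (ctens (dia_id DiTL a) v).
Proof. exact: heq_cast. Qed.

Lemma act_comp a c d e (v : DHom R TL d e) (w : DHom R TL c d) :
  act a (v ** w) = act a v ** act a w.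
Proof.
rewrite /act -[dia_id DiTL a]ccomp1l ctens_comp (hcast_comp _ (addnC a d)).
by rewrite ccomp1l.
Qed.

Lemma act1 a c : act a (dia_id TL c) = dia_id DiTL (c + a).
Proof.
apply: heqP; apply: heq_trans (act_heq _ _) _; rewrite ctens11 addnC.
exact: heq_refl.
Qed.

Fact act_linear a c d : linear (@act a c d).
Proof. by move=> z u v; rewrite /act ctens_linr hcast_linear. Qed.
HB.instance Definition _ a c d :=
  GRing.isLinear.Build C (DHom R TL c d) (DH (c + a) (d + a)) _ (@act a c d)
    (@act_linear a c d).

Lemma actD a c d (u v : DHom R TL c d) : act a (u + v) = act a u + act a v.
Proof. exact: linearD. Qed.
Lemma actZ a c d z (u : DHom R TL c d) : act a (z *: u) = z *: act a u.
Proof. exact: linearZ. Qed.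
Lemma act_0 a c d : act a (0 : DHom R TL c d) = 0.
Proof. exact: linear0. Qed.

Lemma ctens_act a b c d (u : DH a b) (v : DHom R TL c d) :
  heq (ctens u v) (act b v ** strands c u).
Proof.
rewrite -[u in ctens u]ccomp1l -[v in ctens _ v]ccomp1r ctens_comp.
by apply: heq_comp; apply: heq_sym; [exact: act_heq | exact: strands_heq].
Qed.

(** The same tensor product factored in both orders. With the evaluation or coevaluation as [v],
    this is naturality of caps and cups in whatever stands to their left. *)
Lemma act_natural a b c d (u : DH a b) (v : DHom R TL c d) :
  act b v ** strands c u = strands d u ** act a v.
Proof.
apply: heqP; apply: heq_trans (heq_sym (ctens_act _ _)) _.
rewrite -[u in ctens u]ccomp1r -[v in ctens _ v]ccomp1l ctens_comp.
by apply: heq_comp; apply: heq_sym; [exact: strands_heq | exact: act_heq].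
Qed.

Lemma act_tens a c d c' d' (v : DHom R TL c d) (v' : DHom R TL c' d') :
  heq (act a (ctens v v')) (act (d + a) v' ** strands c' (act a v)).
Proof.
apply: heq_trans (ctens_act _ _); apply: heq_trans (act_heq _ _) _.
apply: heq_trans (ctensA _ _ _) _.
by apply: heq_tens (heq_refl _); apply: heq_sym; exact: act_heq.
Qed.

Definition cap a : DH a.+2 a := act a (cls (Ev R)).
Definition cup a : DH a a.+2 := act a (cls (Coev R)).
Definition dcc : DH 2 2 := cls (E1 R).

Lemma cap_natural a b (u : DH a b) : cap b ** strand (strand u) = u ** cap a.
Proof. exact: (act_natural u (cls (Ev R))). Qed.

Lemma cup_natural a b (u : DH a b) : strand (strand u) ** cup a = cup b ** u.
Proof. by symmetry; exact: (act_natural u (cls (Coev R))). Qed.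

Lemma cap_cup a : cap a ** cup a = - 2 *: dia_id DiTL a.
Proof.
transitivity (act a (cls (Ev R) ** cls (Coev R))).
  by symmetry; exact: (act_comp a (cls (Ev R)) (cls (Coev R))).
rewrite ccompE.
have -> : cls (Comp (Ev R) (Coev R)) = - 2 *: dia_id TL 0.
  by rewrite [RHS]cscaleE; apply/clsP; exact: deq_loop.
by rewrite linearZ /= act1.
Qed.

Lemma act_tens1 a c d (v : DHom R TL c d) :
  heq (act a (ctens v (dia_id TL 1))) (strand (act a v)).
Proof.
apply: heq_trans (act_tens _ _ _) _; rewrite act1 ccomp1l; exact: heq_refl.
Qed.

Lemma act_1tens a c d (v : DHom R TL c d) :
  heq (act a (ctens (dia_id TL 1) v)) (act a.+1 v).
Proof.
apply: heq_trans (act_tens _ _ _) _; rewrite act1.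
have -> : strands c (dia_id DiTL (1 + a)) = dia_id DiTL (c + (1 + a)).
  by elim: c {v} => //= c ->; rewrite strand1.
by rewrite ccomp1r; exact: heq_refl.
Qed.

Lemma zigzagl a : strand (cap a) ** cup a.+1 = dia_id DiTL a.+1.
Proof.
rewrite -[RHS](act1 a 1).
have <- : ctens (cls (Ev R)) (dia_id TL 1) **
          ctens (dia_id TL 1) (cls (Coev R)) =
          dia_id TL 1.
  by rewrite !ctensE ccompE; apply/clsP; exact: deq_zigzagl.
rewrite (act_comp a (ctens (cls (Ev R)) (dia_id TL 1))).
apply: heqP; apply: heq_sym.
by apply: heq_comp; [exact: (act_tens1 a (cls (Ev R))) |
  exact: (act_1tens a (cls (Coev R)))].
Qed.

Lemma zigzagr a : cap a.+1 ** strand (cup a) = dia_id DiTL a.+1.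
Proof.
rewrite -[RHS](act1 a 1).
have <- : ctens (dia_id TL 1) (cls (Ev R)) **
          ctens (cls (Coev R)) (dia_id TL 1) =
          dia_id TL 1.
  by rewrite !ctensE ccompE; apply/clsP; exact: deq_zigzagr.
rewrite (act_comp a (ctens (dia_id TL 1) (cls (Ev R)))).
apply: heqP; apply: heq_sym.
by apply: heq_comp; [exact: (act_1tens a (cls (Ev R))) |
  exact: (act_tens1 a (cls (Coev R)))].
Qed.

Lemma heq_undec m n (t : dia R TL m n) : heq (cls (undec t)) (act 0 (cls t)).
Proof.
apply: heq_sym; apply: heq_trans (act_heq _ _) _.
by rewrite ctensE; exact: heq_refl.
Qed.

Lemma heq_undec1 c d (t : dia R TL c d) :
  heq (cls (undec (Tens (Id R TL 1) t))) (act 1 (cls t)).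
Proof.
apply: heq_trans (heq_undec _) _; rewrite -ctensE.
exact: (act_1tens 0 (cls t)).
Qed.

Lemma dcc_right : cap 1 ** (strand dcc ** cup 1) = dia_id DiTL 1.
Proof.
apply: etrans _ (proj2 (clsP _ _) (deq_E1_right R)).
apply: etrans _ (ccompE _ _); apply: etrans _ (congr1 _ (ccompE _ _)).
apply: heqP; apply: heq_sym; apply: heq_comp; first exact: heq_undec1.
apply: heq_comp; last exact: heq_undec1.
apply: heq_sym; apply: heq_trans (heq_cast _ _ _) _.
by rewrite ctensE; exact: heq_refl.
Qed.

Lemma dcc_cup : dcc ** cup 0 = 0.
Proof.
apply: etrans _ (proj2 (clsP _ _) (deq_E1_coev R)).
apply: etrans _ (ccompE _ _); apply: heqP.
by apply: heq_comp (heq_refl _) _; apply: heq_sym; exact: heq_undec.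
Qed.

Lemma cap_dcc : cap 0 ** dcc = 0.
Proof.
apply: etrans _ (proj2 (clsP _ _) (deq_ev_E1 R)).
apply: etrans _ (ccompE _ _); apply: heqP.
by apply: heq_comp (heq_refl _); apply: heq_sym; exact: heq_undec.
Qed.

Lemma dcc_sq : dcc ** dcc = - 2 *: dcc.
Proof. by rewrite ccompE [RHS]cscaleE; apply/clsP; exact: deq_E1_sq. Qed.

(** * Crossings and the interchange law *)

Definition cupcap a : DH a.+2 a.+2 := cup a ** cap a.
Definition swap a : DH a.+2 a.+2 := dia_id DiTL a.+2 + cupcap a.

Lemma act_cross a : act a (cls (cross R)) = swap a.
Proof.
rewrite /swap /cupcap -(act1 a 2).
have -> : cls (cross R) = dia_id TL 2 + cls (Coev R) ** cls (Ev R).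
  by rewrite ccompE [RHS]caddE.
rewrite linearD /=; congr (_ + _).
exact: (act_comp a (cls (Coev R)) (cls (Ev R))).
Qed.

Lemma heq_act_dcast a m n m' n' (em : m = m') (en : n = n')
    (t : dia R TL m n) :
  heq (act a (cls (dcast em en t))) (act a (cls t)).
Proof. by case: _ / em; case: _ / en; exact: heq_refl. Qed.

Lemma act_Comp a c d e (f : dia R TL d e) (g : dia R TL c d) :
  act a (cls (Comp f g)) = act a (cls f) ** act a (cls g).
Proof. by rewrite -ccompE act_comp. Qed.

Lemma act_Tens1 a b c d (f : dia R TL c d) :
  heq (act a (cls (Tens f (Id R TL b)))) (strands b (act a (cls f))).
Proof.
rewrite -ctensE; apply: heq_trans (act_tens _ _ _) _.
by rewrite act1 ccomp1l; exact: heq_refl.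
Qed.

Lemma act_1Tens a c d (f : dia R TL c d) :
  heq (act a (cls (Tens (Id R TL 1) f))) (act a.+1 (cls f)).
Proof. by rewrite -ctensE; exact: act_1tens. Qed.

Lemma act_cross1_1 a : heq (act a (cls (cross1 R 1))) (swap a).
Proof.
rewrite -[cross1 R 1]/(Comp (Tens (Id R TL 1) (cross1 R 0))
  (Tens (cross R) (Id R TL 0))) act_Comp.
have -> : swap a = dia_id DiTL a.+2 ** swap a by rewrite ccomp1l.
apply: heq_comp.
  apply: heq_trans (act_1Tens _ _) _.
  by rewrite -/(dia_id TL 1) act1; exact: heq_refl.
apply: heq_trans (act_Tens1 a 0 (cross R)) _; rewrite /= act_cross.
exact: heq_refl.
Qed.

Lemma act_cross1_2 a :
  heq (act a (cls (cross1 R 2))) (swap a.+1 ** strand (swap a)).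
Proof.
rewrite -[cross1 R 2]/(Comp (Tens (Id R TL 1) (cross1 R 1))
  (Tens (cross R) (Id R TL 1))) act_Comp.
apply: heq_comp.
  by apply: heq_trans (act_1Tens _ _) _; exact: act_cross1_1.
apply: heq_trans (act_Tens1 a 1 (cross R)) _; rewrite /= act_cross.
exact: heq_refl.
Qed.

Lemma act_crossing12 a :
  heq (act a (cls (crossing R 1 2))) (swap a.+1 ** strand (swap a)).
Proof.
apply: heq_trans (heq_act_dcast _ _ _ _) _; rewrite act_Comp.
have -> : swap a.+1 ** strand (swap a) =
          (swap a.+1 ** strand (swap a)) ** dia_id DiTL a.+3 by rewrite ccomp1r.
apply: heq_comp.
  by apply: heq_trans (act_Tens1 _ _ _) _; exact: act_cross1_2.
apply: heq_trans (act_1Tens _ _) _; apply: heq_trans (heq_act_dcast _ _ _ _) _.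
by rewrite -/(dia_id TL 2) act1; exact: heq_refl.
Qed.

Lemma heq_strand m n m' n' (u : DH m n) (v : DH m' n') :
  heq u v -> heq (strand u) (strand v).
Proof.
case=> em [en]; case: _ / em v => v; case: _ / en v => v <-; exact: heq_refl.
Qed.

Lemma act_crossing22 :
  heq (act 0 (cls (crossing R 2 2)))
      (strand (swap 1) ** strand (strand (swap 0)) **
       (swap 2 ** strand (swap 1))).
Proof.
apply: heq_trans (heq_act_dcast _ _ _ _) _; rewrite act_Comp.
apply: heq_comp.
  apply: heq_trans (act_Tens1 _ _ _) _; rewrite -strand_comp.
  by apply: heq_strand; exact: act_cross1_2.
by apply: heq_trans (act_1Tens _ _) _; exact: act_crossing12.
Qed.

(** Two copies of the decorated cup-cap side by side may be applied in either order. Here [s] moves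
    one pair of strands past the other; dots are reached from the left only, so the right-hand copy
    is [s ** (e ** s)]. *)
Lemma dcc_slide (s := strand (swap 1) ** strand (strand (swap 0)) **
                      (swap 2 ** strand (swap 1)))
    (e := strand (strand dcc)) :
  e ** (s ** (e ** s)) = s ** (e ** s) ** e.
Proof.
have S : heq (cls (undec (crossing R 2 2))) s.
  by apply: heq_trans (heq_undec _) _; exact: act_crossing22.
have E : heq (cls (Tens (E1 R) (Id R TL 2))) e.
  by rewrite -ctensE; apply: heq_sym; exact: (strands_heq 2).
have P : heq (cls (pull 2 (E1 R))) (s ** (e ** s)).
  rewrite /pull -ccompE -ccompE.
  by apply: heq_comp => //; apply: heq_comp.
apply: heqP; apply: heq_trans (heq_sym (heq_comp E P)) _.
apply: heq_trans (heq_comp P E).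
rewrite !ccompE (proj2 (clsP _ _) (deq_slide (E1 R) (E1 R))).
exact: heq_refl.
Qed.

End Calculus.

(** * The fusion relation *)

Section IntegerCombinations.
Variables (K : fieldType) (V : lmodType K) (atom : nat -> V) (n : nat).

(* Integer combinations of the atoms with index < n, as lists of
   (coefficient, index); used to decide linear identities by computation. *)
Definition intcomb (s : seq (int * nat)) : V :=
  \sum_(p <- s) p.1%:~R *: atom p.2.

Definition intcoef (s : seq (int * nat)) (j : nat) : int :=
  foldr (fun p a => (if p.2 == j then p.1 else 0) + a) 0 s.

Definition intsubst (T : seq (seq (int * nat))) (s : seq (int * nat)) :=
  flatten [seq [seq (p.1 * q.1, q.2) | q <- nth [::] T p.2] | p <- s].

Definition intcomb_eqb (s t : seq (int * nat)) : bool :=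
  [&& all (fun p => p.2 < n)%N s, all (fun p => p.2 < n)%N t &
      all (fun j => intcoef s j == intcoef t j) (iota 0 n)].

Lemma intcomb_coef s : all (fun p => p.2 < n)%N s ->
  intcomb s = \sum_(j < n) (intcoef s j)%:~R *: atom j.
Proof.
rewrite /intcomb; elim: s => [_|[a i] s IH] /=.
  by rewrite big_nil big1 // => j _; rewrite scale0r.
case/andP=> ltin /IH; rewrite big_cons => -> /=.
under [RHS]eq_bigr do rewrite intrD scalerDl.
rewrite big_split /=; congr (_ + _).
rewrite (bigD1 (Ordinal ltin)) //= eqxx big1 ?addr0 // => j.
by rewrite -val_eqE /= eq_sym => /negPf ->; rewrite scale0r.
Qed.

Lemma intcomb_eq s t : intcomb_eqb s t -> intcomb s = intcomb t.
Proof.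
case/and3P=> Hs Ht /allP E; rewrite !intcomb_coef //.
by apply: eq_bigr => j _; rewrite (eqP (E j _)) // mem_iota ltn_ord.
Qed.

Lemma intcomb_subst (f : V -> V) T s :
    (forall u v, f (u + v) = f u + f v) ->
    (forall a u, f (a *: u) = a *: f u) ->
    (forall i, (i < n)%N -> f (atom i) = intcomb (nth [::] T i)) ->
    all (fun p => p.2 < n)%N s ->
  f (intcomb s) = intcomb (intsubst T s).
Proof.
move=> fD fZ fT; rewrite /intcomb /intsubst; elim: s => [_|[a i] s IH] /=.
  by rewrite !big_nil; have := fZ 0 0; rewrite !scale0r.
case/andP=> ltin /IH E; rewrite big_cons fD E fZ big_cat /=; congr (_ + _).
rewrite fT // big_map scaler_sumr; apply: eq_bigr => q _.
by rewrite scalerA -intrM.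
Qed.

End IntegerCombinations.

Section Fusion.
Variable R : realType.
Local Notation C := R[i].
Local Notation DH := (DHom R DiTL).
Local Infix "**" := (@ccomp R _ _ _ _) (at level 40, left associativity).
Local Notation t1 := strand.
Local Notation D := (dcc R).
Local Notation U := (cupcap R).

Lemma cupcap_sq a : U a ** U a = - 2 *: U a.
Proof.
by rewrite /cupcap -ccompA (ccompA (cap R a)) cap_cup ccompZl ccomp1l ccompZr.
Qed.
Lemma cupcap_cup a : U a ** cup R a = - 2 *: cup R a.
Proof. by rewrite /cupcap -ccompA cap_cup ccompZr ccomp1r. Qed.
Lemma cap_cupcap a : cap R a ** U a = - 2 *: cap R a.
Proof. by rewrite /cupcap ccompA cap_cup ccompZl ccomp1l. Qed.
Lemma dcc_cupcap : D ** U 0 = 0.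
Proof. by rewrite /cupcap ccompA dcc_cup ccomp0l. Qed.
Lemma cupcap_dcc : U 0 ** D = 0.
Proof. by rewrite /cupcap -ccompA cap_dcc ccomp0r. Qed.

(** The three positions of a cup inserted next to two strands, and the generators acting on the
    resulting four strands. The product [d] does not reduce to the others. *)
Let c0 : DH 2 4 := t1 (t1 (cup R 0)).
Let c1 : DH 2 4 := t1 (cup R 1).
Let c2 : DH 2 4 := cup R 2.
Let e0 : DH 4 4 := t1 (t1 D).
Let u0 : DH 4 4 := t1 (t1 (U 0)).
Let u1 : DH 4 4 := t1 (U 1).
Let u2 : DH 4 4 := U 2.
Let d : DH 2 4 := e0 ** c1.

Let u0c0 : u0 ** c0 = - 2 *: c0.
Proof. by rewrite /u0 /c0 -!strand_comp cupcap_cup !linearZ. Qed.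
Let u0c1 : u0 ** c1 = c0.
Proof.
by rewrite /u0 /c1 -strand_comp (strand_comp (cup R 0)) -ccompA zigzagl ccomp1r.
Qed.
Let u0c2 : u0 ** c2 = c2 ** U 0.
Proof. exact: cup_natural. Qed.
Let u0d : u0 ** d = 0.
Proof.
by rewrite /d ccompA /u0 /e0 -!strand_comp cupcap_dcc !(linear0, ccomp0l).
Qed.
Let u1c0 : u1 ** c0 = c1.
Proof.
by rewrite /u1 /c0 -!strand_comp /cupcap -ccompA zigzagr ccomp1r.
Qed.
Let u1c1 : u1 ** c1 = - 2 *: c1.
Proof. by rewrite /u1 /c1 -!strand_comp cupcap_cup linearZ. Qed.
Let u1c2 : u1 ** c2 = c1.
Proof. by rewrite /u1 /cupcap strand_comp -ccompA zigzagl ccomp1r. Qed.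
Let u1d : u1 ** d = c1.
Proof.
by rewrite /u1 /d /e0 /c1 -!strand_comp /cupcap -ccompA dcc_right ccomp1r.
Qed.
Let u2c0 : u2 ** c0 = c2 ** U 0.
Proof. by rewrite /u2 /c0 /cupcap -!ccompA cap_natural. Qed.
Let u2c1 : u2 ** c1 = c2.
Proof. by rewrite /u2 /cupcap -ccompA zigzagr ccomp1r. Qed.
Let u2c2 : u2 ** c2 = - 2 *: c2.
Proof. exact: cupcap_cup. Qed.
Let u2d : u2 ** d = c2 ** D.
Proof.
rewrite /u2 /d /cupcap -ccompA (ccompA (cap R 2)) cap_natural -ccompA zigzagr.
by rewrite ccomp1r.
Qed.
Let e0c0 : e0 ** c0 = 0.
Proof. by rewrite /e0 /c0 -!strand_comp dcc_cup !linear0. Qed.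
Let e0c2 : e0 ** c2 = c2 ** D.
Proof. exact: cup_natural. Qed.
Let e0d : e0 ** d = - 2 *: d.
Proof.
rewrite /d ccompA /e0 -(strand_comp (t1 D)) -strand_comp dcc_sq.
by rewrite !strandZ ccompZl.
Qed.
Let c0U : c0 ** U 0 = c2 ** U 0.
Proof. by rewrite /c0 /cupcap ccompA cup_natural -ccompA. Qed.

(** The span of these morphisms is stable under composition with [u0], [u1], [u2] and [e0], so both
    sides of the interchange law can be evaluated with integer tables. *)
Let atoms : seq (DH 2 4) :=
  [:: c0; c1; c2; c0 ** D; c1 ** D; c2 ** D; c1 ** U 0; c2 ** U 0;
      d; d ** U 0; d ** D].
Let atom i := nth 0 atoms i.
Let lc : _ -> DH 2 4 := intcomb atom.

(* Entry i of each table expands the image of the i-th atom under the named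
   operator; [Negz 1] is -2. *)
Let one (i : nat) : int * nat := (Posz 1, i).
Let mtwo (i : nat) : int * nat := (Negz 1, i).
Let tab_u0 := [:: [:: mtwo 0]; [:: one 0]; [:: one 7]; [:: mtwo 3];
  [:: one 3]; [::]; [:: one 7]; [:: mtwo 7]; [::]; [::]; [::]]%N.
Let tab_u1 := [:: [:: one 1]; [:: mtwo 1]; [:: one 1]; [:: one 4];
  [:: mtwo 4]; [:: one 4]; [:: mtwo 6]; [:: one 6]; [:: one 1]; [:: one 6];
  [:: one 4]]%N.
Let tab_u2 := [:: [:: one 7]; [:: one 2]; [:: mtwo 2]; [::]; [:: one 5];
  [:: mtwo 5]; [:: one 7]; [:: mtwo 7]; [:: one 5]; [::]; [:: mtwo 5]]%N.
Let tab_e0 := [:: [::]; [:: one 8]; [:: one 5]; [::]; [:: one 10];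
  [:: mtwo 5]; [:: one 9]; [::]; [:: mtwo 8]; [:: mtwo 9]; [:: mtwo 10]]%N.

Let lc1 a i : lc [:: (a, i)] = a%:~R *: atom i.
Proof. by rewrite /lc /intcomb big_seq1. Qed.
Let lc0 : lc [::] = 0.
Proof. by rewrite /lc /intcomb big_nil. Qed.

Let assocR := (u0c0, u0c1, u0c2, u0d, u1c0, u1c1, u1c2, u1d,
  u2c0, u2c1, u2c2, u2d, e0c0, e0c2, e0d).

Ltac table :=
  case=> [|[|[|[|[|[|[|[|[|[|[|//]]]]]]]]]]] _;
  rewrite /= -/(lc _) ?lc0 ?lc1 /atom /= ?(ccompA _ _ (U 0)) ?(ccompA _ _ D)
    ?assocR ?ccompZl ?ccomp0l
    -?(ccompA _ (U 0) (U 0)) -?(ccompA _ D (U 0)) -?(ccompA _ (U 0) D)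
    -?(ccompA _ D D) ?cupcap_sq ?dcc_sq ?dcc_cupcap ?cupcap_dcc ?ccomp0r
    ?ccompZr ?c0U ?scale1r //.

Let tab_u0P i : (i < 11)%N -> u0 ** atom i = lc (nth [::] tab_u0 i).
Proof. move: i; table. Qed.
Let tab_u1P i : (i < 11)%N -> u1 ** atom i = lc (nth [::] tab_u1 i).
Proof. move: i; table. Qed.
Let tab_u2P i : (i < 11)%N -> u2 ** atom i = lc (nth [::] tab_u2 i).
Proof. move: i; table. Qed.
Let tab_e0P i : (i < 11)%N -> e0 ** atom i = lc (nth [::] tab_e0 i).
Proof. move: i; table. Qed.

Let intswap T s := s ++ intsubst T s.

Let lc_step (o : DH 4 4) T s :
    (forall i, (i < 11)%N -> o ** atom i = lc (nth [::] T i)) ->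
    all (fun p => p.2 < 11)%N s ->
  o ** lc s = lc (intsubst T s).
Proof.
move=> oT s11.
apply: (@intcomb_subst _ _ atom 11 (fun x : DH 2 4 => o ** x) T) => //.
- by move=> u v; rewrite ccompDr.
- by move=> a u; rewrite ccompZr.
Qed.

Let lc_swap (o : DH 4 4) T s :
    (forall i, (i < 11)%N -> o ** atom i = lc (nth [::] T i)) ->
    all (fun p => p.2 < 11)%N s ->
  (dia_id R DiTL 4 + o) ** lc s = lc (intswap T s).
Proof.
move=> oT s11; rewrite ccompDl ccomp1l (lc_step oT s11) /intswap.
by rewrite /lc /intcomb big_cat.
Qed.

Let s4 : DH 4 4 := strand (swap R 1) ** strand (strand (swap R 0)) **
                   (swap R 2 ** strand (swap R 1)).

(** [s4] is a product of four factors [1 + u_i]; its rightmost factor acts first, which fixes the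
    nesting. *)
Let intcross s :=
  intswap tab_u1 (intswap tab_u0 (intswap tab_u2 (intswap tab_u1 s))).

Let lc_cross s : all (fun p => p.2 < 11)%N s ->
    all (fun p => p.2 < 11)%N (intswap tab_u1 s) ->
    all (fun p => p.2 < 11)%N (intswap tab_u2 (intswap tab_u1 s)) ->
    all (fun p => p.2 < 11)%N
      (intswap tab_u0 (intswap tab_u2 (intswap tab_u1 s))) ->
  s4 ** lc s = lc (intcross s).
Proof.
move=> H0 H1 H2 H3; rewrite /s4 /swap !linearD /= !strand1 -!ccompA.
by rewrite !(lc_swap tab_u1P, lc_swap tab_u2P, lc_swap tab_u0P).
Qed.

(** Both sides of the interchange law are applied to the middle cup. The results agree in the term
    [d ** U 0] and have opposite terms in [d ** D] and [c2 ** D], so twice the wanted difference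
    vanishes. *)
Lemma dcc_cup_dcc : e0 ** c1 ** D = c2 ** D.
Proof.
have H (x : DH 2 4) :
    e0 ** (s4 ** (e0 ** (s4 ** x))) = s4 ** (e0 ** (s4 ** (e0 ** x))).
  by have := congr1 (fun y => y ** x) (dcc_slide R); rewrite -!ccompA.
(* The list encodes [c1], the cup inserted between the two strands. *)
have := H (lc [:: (Posz 1, 1%N)]).
rewrite !(lc_cross, lc_step tab_e0P) //.
set x := lc _; set y := lc _ => E.
have Ex : x = lc [:: (Negz 0, 10); (Posz 1, 5); (Posz 1, 9)]%N.
  by apply: (@intcomb_eq _ _ atom 11); vm_compute.
have Ey : y = lc [:: (Posz 1, 10); (Negz 0, 5); (Posz 1, 9)]%N.
  by apply: (@intcomb_eq _ _ atom 11); vm_compute.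
move: E; rewrite Ex Ey /lc /intcomb !big_cons !big_nil /atom /=.
rewrite !scale1r !scaleN1r !addr0 !addrA => /addIr E.
have : (2 : C) *: (d ** D - c2 ** D) = 0.
  by rewrite scaler_nat mulr2n -{1}E addrACA addNr subrr addr0.
move/eqP; rewrite scaler_eq0 pnatr_eq0 /= subr_eq0 => /eqP; exact.
Qed.

End Fusion.

(** * Jones-Wenzl projections *)

Section JonesWenzl.
Variable R : realType.
Local Notation C := R[i].
Local Notation DH := (DHom R DiTL).
Local Infix "**" := (@ccomp R _ _ _ _) (at level 40, left associativity).
Local Notation t1 := strand.
Local Notation D := (dcc R).
Local Notation U := (cupcap R).
Local Notation dia_id := (dia_id R DiTL).
Local Notation cap := (cap R).
Local Notation cup := (cup R).

(** Bending the last output strand of [dcc_cup_dcc] down to an input gives this relation of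
    Temperley-Lieb type. *)
Lemma dcc_fusion : t1 D ** U 1 ** t1 D = t1 D.
Proof.
have := congr1 (fun x => cap 3 ** t1 x) (dcc_cup_dcc R).
rewrite -strand_comp !(strand_comp _ D) !ccompA zigzagr ccomp1l cap_natural.
by [].
Qed.

Lemma cap_strand_cupcap_cup a : cap a.+1 ** t1 (U a) ** cup a.+1 = dia_id a.+1.
Proof.
by rewrite /cupcap strand_comp !ccompA zigzagr ccomp1l zigzagl.
Qed.

(* The projection of V^{(x) (k+1)} onto the span of v_1^{(x) (k+1)} and
   v_2^{(x) (k+1)}, by a Jones-Wenzl recursion. *)
Definition jw_step k (p : DH k.+1 k.+1) : DH k.+2 k.+2 :=
  match k return DH k.+1 k.+1 -> DH k.+2 k.+2 with
  | 0 => fun=> dia_id 2 + 2^-1 *: (D + U 0)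
  | _.+1 => fun p => t1 p + t1 p ** U _ ** t1 p
  end p.

Fixpoint jw k : DH k.+1 k.+1 :=
  if k is k'.+1 then jw_step (jw k') else dia_id 1.

Lemma jwSS k : jw k.+2 = t1 (jw k.+1) + t1 (jw k.+1) ** U k.+1 ** t1 (jw k.+1).
Proof. by []. Qed.

(** [- h] is the sum of the two orthogonal idempotents for the sign character and the trivial
    representation. *)
Let h : DH 2 2 := 2^-1 *: (D + U 0).
Let two_unit : (2 : C) != 0. Proof. by rewrite pnatr_eq0. Qed.

Let hh : h ** h = - h.
Proof.
rewrite /h ccompZl ccompZr ccompDl !ccompDr dcc_sq cupcap_sq dcc_cupcap.
rewrite cupcap_dcc addr0 add0r -scalerDr !scalerA -scaleNr.
by congr (_ *: _); field.
Qed.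

(** The partial trace drives the induction: being [- jw k], it makes the two terms of the recursion
    cancel against a cup or a cap, and idempotence follows from that cancellation. It also accounts
    for the coefficient 1 in the recursion. *)
Lemma jw_props k :
  [/\ jw k ** jw k = jw k /\ jw k.+1 ** jw k.+1 = jw k.+1,
      jw k.+1 ** t1 (jw k) = jw k.+1 /\ t1 (jw k) ** jw k.+1 = jw k.+1,
      cap k.+1 ** t1 (jw k.+1) ** cup k.+1 = - jw k,
      cap k ** jw k.+1 = 0 & jw k.+1 ** cup k = 0].
Proof.
elim: k => [|k [[J1 J1'] [J2l J2r] J3 J4l J4r]].
  split.
  - split; first by rewrite ccomp1l.
    rewrite /= -/h ccompDl ccomp1l ccompDr ccomp1r hh.
    by rewrite [h + _]addrC addNr addr0.
  - by rewrite strand1 ccomp1l ccomp1r.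
  (* Closing the last strand gives -2 from the loop, 1/2 from [dcc_right] and 1/2 from the zigzags:
     -1 in total. *)
  - rewrite /= strandD strandZ strandD ccompDr ccompDl strand1 ccomp1r.
    rewrite ccompZr ccompZl ccompDr ccompDl cap_cup cap_strand_cupcap_cup.
    rewrite -ccompA dcc_right -[dia_id 1 + dia_id 1]mulr2n.
    rewrite -[dia_id 1 *+ 2]scaler_nat scalerA mulVf // -scalerDl.
    by rewrite -[RHS]scaleN1r; congr (_ *: _); ring.
  - rewrite /= ccompDr ccomp1r ccompZr ccompDr cap_dcc cap_cupcap add0r scalerA.
    by rewrite mulrN mulVf // scaleN1r subrr.
  - rewrite /= ccompDl ccomp1l ccompZl ccompDl dcc_cup cupcap_cup add0r scalerA.
    by rewrite mulrN mulVf // scaleN1r subrr.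
have P2l : t1 (jw k.+1) ** t1 (t1 (jw k)) = t1 (jw k.+1).
  by rewrite -strand_comp J2l.
have P2r : t1 (t1 (jw k)) ** t1 (jw k.+1) = t1 (jw k.+1).
  by rewrite -strand_comp J2r.
have PP : t1 (jw k.+1) ** t1 (jw k.+1) = t1 (jw k.+1).
  by rewrite -strand_comp J1'.
have J3' : cap k.+1 ** (t1 (jw k.+1) ** cup k.+1) = - jw k by rewrite ccompA.
have Pl : jw k.+2 ** t1 (jw k.+1) = jw k.+2.
  by rewrite jwSS ccompDl PP -(ccompA _ (t1 _) (t1 _)) PP.
have Pr : t1 (jw k.+1) ** jw k.+2 = jw k.+2.
  by rewrite jwSS ccompDr PP -(ccompA _ (U _)) (ccompA (t1 _) (t1 _)) PP.
have K4r : jw k.+2 ** cup k.+1 = 0.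
  rewrite jwSS ccompDl /cupcap -!ccompA J3' !ccompNr -cup_natural.
  by rewrite (ccompA (t1 _)) P2l subrr.
have K4l : cap k.+1 ** jw k.+2 = 0.
  rewrite jwSS ccompDr /cupcap !ccompA J3 !ccompNl -cap_natural.
  by rewrite -(ccompA (cap _)) P2r subrr.
split=> //.
- split=> //; rewrite {2}jwSS ccompDr Pl (ccompA (jw _)) (ccompA (jw _)) Pl.
  by rewrite /cupcap (ccompA (jw _)) K4r !ccomp0l addr0.
(* The first term closes to a loop, contributing -2; in the second both zigzags straighten,
   contributing 1. *)
- rewrite [jw k.+2]jwSS strandD ccompDr ccompDl !strand_comp.
  rewrite !ccompA cap_natural -(ccompA _ (t1 (t1 _))) cup_natural.
  rewrite -!ccompA cap_cup ccompZr ccomp1r (ccompA (cap _) (t1 (cup _))).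
  rewrite zigzagr ccomp1l (ccompA (t1 (cap _))) zigzagl ccomp1l J1'.
  rewrite -[X in _ + X]scale1r -scalerDl -[RHS]scaleN1r.
  by congr (_ *: _); ring.
Qed.

Lemma jw_idem k : jw k ** jw k = jw k.
Proof. by have [[]] := jw_props k. Qed.
Lemma jw_strandl k : jw k.+1 ** t1 (jw k) = jw k.+1.
Proof. by have [_ []] := jw_props k. Qed.
Lemma jw_strandr k : t1 (jw k) ** jw k.+1 = jw k.+1.
Proof. by have [_ []] := jw_props k. Qed.
Lemma jw_trace k : cap k.+1 ** t1 (jw k.+1) ** cup k.+1 = - jw k.
Proof. by have [] := jw_props k. Qed.
Lemma cap_jw k : cap k ** jw k.+1 = 0.
Proof. by have [] := jw_props k. Qed.
Lemma jw_cup k : jw k.+1 ** cup k = 0.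
Proof. by have [] := jw_props k. Qed.

Lemma dcc_jw : D ** jw 1 = 0.
Proof.
rewrite /= ccompDr ccomp1r ccompZr ccompDr dcc_sq dcc_cupcap addr0 scalerA.
by rewrite mulrN mulVf // scaleN1r subrr.
Qed.
Lemma jw_dcc : jw 1 ** D = 0.
Proof.
rewrite /= ccompDl ccomp1l ccompZl ccompDl dcc_sq cupcap_dcc addr0 scalerA.
by rewrite mulrN mulVf // scaleN1r subrr.
Qed.

End JonesWenzl.

(** * Path bases *)

Local Arguments jw _ _ : simpl never.

Section PathBasis.
Variable R : realType.
Local Notation C := R[i].
Local Notation DH := (DHom R DiTL).
Local Infix "**" := (@ccomp R _ _ _ _) (at level 40, left associativity).
Local Notation t1 := strand.
Local Notation D := (dcc R).
Local Notation U := (cupcap R).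
Local Notation dia_id := (dia_id R DiTL).
Local Notation cap := (cap R).
Local Notation cup := (cup R).
Local Notation jw := (jw R).

(** Since [D] squares to -2 times itself, this is the idempotent for the sign character, with image
    spanned by the symmetric tensor of $v_1$ and $v_2$. *)
Definition chi : DH 2 2 := - 2^-1 *: D.

Let two_unit : (2 : C) != 0. Proof. by rewrite pnatr_eq0. Qed.

Lemma chi_idem : chi ** chi = chi.
Proof.
by rewrite /chi ccompZl ccompZr dcc_sq !scalerA; congr (_ *: _); field.
Qed.
Lemma chi_cup : chi ** cup 0 = 0.
Proof. by rewrite /chi ccompZl dcc_cup scaler0. Qed.
Lemma cap_chi : cap 0 ** chi = 0.
Proof. by rewrite /chi ccompZr cap_dcc scaler0. Qed.
Lemma chi_jw : chi ** jw 1 = 0.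
Proof. by rewrite /chi ccompZl dcc_jw scaler0. Qed.
Lemma jw_chi : jw 1 ** chi = 0.
Proof. by rewrite /chi ccompZr jw_dcc scaler0. Qed.
Lemma chi_trace : cap 1 ** (t1 chi ** cup 1) = - 2^-1 *: dia_id 1.
Proof. by rewrite /chi strandZ ccompZl ccompZr dcc_right. Qed.
(** A rescaling of [dcc_fusion]: the sign character tensored with V is V. The factor -2 inverts the
    scalar in [chi_trace]. *)
Lemma chi_fusion :
  (t1 chi ** cup 1) ** (- 2 *: (cap 1 ** t1 chi)) = t1 chi.
Proof.
rewrite /chi strandZ !(ccompZl, ccompZr) !ccompA.
by rewrite -(ccompA _ (cup 1)) dcc_fusion !scalerA; congr (_ *: _); field.
Qed.

(* The simple representations of Dic_oo occurring in the tensor powers of V: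
   the trivial one, the sign character of Dic_oo/<a>, and for each k the
   two-dimensional one spanned by the (k+1)st powers of v_1 and v_2. *)
Inductive vertex := Triv | Sign | Wt of nat.

Definition vsize v := match v with Triv => 0 | Sign => 2 | Wt k => k.+1 end%N.

Definition vproj v : DH (vsize v) (vsize v) :=
  match v return DH (vsize v) (vsize v) with
  | Triv => dia_id 0 | Sign => chi | Wt k => jw k
  end.

(** The spanning morphism that Schur's lemma predicts between two vertices. The match on [eqP]
    supplies the equality along which [jw k] is transported. *)
Definition vhom v w : DH (vsize v) (vsize w) :=
  match v, w return DH (vsize v) (vsize w) with
  | Triv, Triv => dia_id 0
  | Sign, Sign => chi
  | Wt k, Wt l =>
      if @eqP _ k l is ReflectT e then hcast erefl (congr1 S e) (jw k) else 0
  | _, _ => 0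
  end.

Lemma vhomxx v : vhom v v = vproj v.
Proof. by case: v => [||k] //=; case: eqP => // e; rewrite hcast_id. Qed.

Lemma vhomP v w : v = w \/ vhom v w = 0.
Proof.
case: v w => [||k] [||l] /=; try by [left | right].
by case: eqP => [e|_]; [left; rewrite e | right].
Qed.

(** For distinct vertices this means that [x] vanishes, for equal ones that it is a multiple of the
    vertex idempotent. *)
Definition scal v w (x : DH (vsize v) (vsize w)) := exists a, x = a *: vhom v w.

Lemma scal0 v w : scal (0 : DH (vsize v) (vsize w)).
Proof. by exists 0; rewrite scale0r. Qed.

Lemma scalD v w (x y : DH (vsize v) (vsize w)) :
  scal x -> scal y -> scal (x + y).
Proof. by move=> [a ->] [b ->]; exists (a + b); rewrite scalerDl. Qed.

Lemma scalZ v w a (x : DH (vsize v) (vsize w)) : scal x -> scal (a *: x).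
Proof. by move=> [b ->]; exists (a * b); rewrite scalerA. Qed.

Lemma scalN v w (x : DH (vsize v) (vsize w)) : scal x -> scal (- x).
Proof. by rewrite -scaleN1r; apply: scalZ. Qed.

Lemma scal_vproj v : scal (vproj v).
Proof. by exists 1; rewrite scale1r vhomxx. Qed.

Lemma vproj_idem v : vproj v ** vproj v = vproj v.
Proof.
by case: v => [||k] /=; rewrite ?ccomp1l ?chi_idem ?jw_idem.
Qed.

Lemma scal_comp u v w (y : DH (vsize v) (vsize w))
    (x : DH (vsize u) (vsize v)) :
  scal y -> scal x -> scal (y ** x).
Proof.
move=> [b ->] [a ->]; rewrite ccompZl ccompZr; do 2!apply: scalZ.
have [e|->] := vhomP u v; last by rewrite ccomp0r; apply: scal0.
have [f|->] := vhomP v w; last by rewrite ccomp0l; apply: scal0.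
by rewrite -f -e !vhomxx vproj_idem; apply: scal_vproj.
Qed.

(** Meant as a summand of n strands of type [lv], with inclusion [lu] and projection [ld]; the
    equations making it one are proved separately. *)
Record leg n := Leg {
  lv : vertex; lu : DH (vsize lv) n; ld : DH n (vsize lv) }.
Arguments Leg {n}.

(** The decomposition of a vertex tensored with V. The scalars invert the traces of [cap_cup],
    [chi_trace] and [jw_trace], so that the two halves of an edge compose to the vertex
    idempotent. *)
Definition edges v : seq (leg (vsize v).+1) :=
  match v return seq (leg (vsize v).+1) with
  | Triv => [:: Leg (Wt 0) (dia_id 1) (dia_id 1)]
  | Sign => [:: Leg (Wt 0) (t1 chi ** cup 1) (- 2 *: (cap 1 ** t1 chi))]
  | Wt 0 => [:: Leg Triv (cup 0) (- 2^-1 *: cap 0); Leg Sign chi chi;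
                Leg (Wt 1) (jw 1) (jw 1)]
  | Wt k.+1 => [:: Leg (Wt k.+2) (jw k.+2) (jw k.+2);
                   Leg (Wt k) (t1 (jw k.+1) ** cup k.+1)
                              (- (cap k.+1 ** t1 (jw k.+1)))]
  end.

(** At [Sign] this is the fusion relation; at the vertices [Wt k] it is the Jones-Wenzl recursion
    solved for its leading term. *)
Lemma edges_complete v : t1 (vproj v) = \sum_(l <- edges v) lu l ** ld l.
Proof.
case: v => [||[|k]]; rewrite /= !big_cons big_nil /= addr0.
- by rewrite strand1 ccomp1l.
- by rewrite chi_fusion.
- rewrite strand1 chi_idem jw_idem ccompZr -/(U 0) /jw /= scalerDr /chi.
  rewrite !scaleNr.
  by rewrite addrA -opprD [_ *: U 0 + _]addrC addrC addrK.
- rewrite jw_idem ccompNr jwSS !ccompA -(ccompA _ (cup _) (cap _)).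
  by rewrite addrK.
Qed.

Definition edge_ok v (l : leg (vsize v).+1) :=
  [/\ t1 (vproj v) ** lu l = lu l, ld l ** t1 (vproj v) = ld l &
      lu l ** vproj (lv l) = lu l].

Lemma edgesP v l : List.In l (edges v) -> edge_ok l.
Proof.
case: v l => [||[|k]] l /=.
- by case=> [<-|//]; split=> /=; rewrite ?strand1 ?ccomp1l.
- case=> [<-|//]; split=> /=; rewrite ?ccomp1r //.
    by rewrite ccompA -strand_comp chi_idem.
  by rewrite ccompZl -ccompA -strand_comp chi_idem.
- by case=> [|[|[|//]]] <-; split=> /=;
     rewrite ?strand1 ?ccomp1l ?ccomp1r ?chi_idem ?jw_idem.
- case=> [|[|//]] <-; split=> /=.
  + by rewrite jw_strandr.
  + by rewrite jw_strandl.
  + by rewrite jw_idem.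
  + by rewrite ccompA -strand_comp jw_idem.
  + by rewrite ccompNl -ccompA -strand_comp jw_idem.
  + by rewrite -ccompA -cup_natural ccompA -strand_comp jw_strandl.
Qed.

(** Distinct edges compose to zero because the idempotents involved kill caps and cups and [chi] is
    orthogonal to [jw 1]; an edge composed with itself is an idempotent or a trace. *)
Lemma edges_orth v l l' : List.In l (edges v) -> List.In l' (edges v) ->
  scal (ld l ** lu l').
Proof.
case: v l l' => [||[|k]] l l' /=.
- case=> [<-|//] [<-|//] /=; rewrite ccomp1l; exact: (scal_vproj (Wt 0)).
- case=> [<-|//] [<-|//] /=; rewrite ccompZl -ccompA (ccompA (t1 _)).
  rewrite -strand_comp chi_idem chi_trace; do 2!apply: scalZ.
  exact: (scal_vproj (Wt 0)).
- case=> [|[|[|//]]] <-; case=> [|[|[|//]]] <- /=;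
    rewrite ?chi_cup ?chi_idem ?chi_jw ?jw_cup ?jw_chi ?jw_idem
      ?(ccompZl _ (cap 0)) ?cap_cup ?cap_chi ?cap_jw ?scaler0;
    try exact: scal0.
  + by do 2!apply: scalZ; exact: (scal_vproj Triv).
  + exact: (scal_vproj Sign).
  + exact: (scal_vproj (Wt 1)).
- case=> [|[|//]] <-; case=> [|[|//]] <- /=.
  + by rewrite jw_idem; exact: (scal_vproj (Wt k.+2)).
  + by rewrite ccompA jw_strandl jw_cup; exact: scal0.
  + by rewrite ccompNl -ccompA jw_strandr cap_jw oppr0; exact: scal0.
  + rewrite ccompNl -ccompA (ccompA (t1 _)) -strand_comp jw_idem ccompA.
    by rewrite jw_trace opprK; exact: (scal_vproj (Wt k)).
Qed.

(** Capping two successive edges gives zero unless the second returns to [v]; then a trace or a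
    zigzag leaves a multiple of the idempotent. *)
Lemma cap_edges v l : List.In l (edges v) ->
  forall l', List.In l' (edges (lv l)) ->
  scal (vproj v ** cap (vsize v) ** (t1 (lu l) ** lu l')).
Proof.
case: v l => [||[|k]] l /=.
- case=> [<-|//] l' /= [|[|[|//]]] <- /=; rewrite strand1 !ccomp1l.
  + by rewrite cap_cup; apply: scalZ; exact: (scal_vproj Triv).
  + by rewrite cap_chi; exact: scal0.
  + by rewrite cap_jw; exact: scal0.
- have E : chi ** cap 2 ** t1 (t1 chi ** cup 1) = chi.
    rewrite -ccompA strand_comp (ccompA (cap 2)) cap_natural -ccompA zigzagr.
    by rewrite ccomp1r chi_idem.
  case=> [<-|//] l' /= [|[|[|//]]] <- /=; rewrite ccompA E.
  + by rewrite chi_cup; exact: scal0.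
  + by rewrite chi_idem; exact: (scal_vproj Sign).
  + by rewrite chi_jw; exact: scal0.
- rewrite -[jw 0]/(dia_id 1) ccomp1l; case=> [|[|[|//]]] <- l' /=.
  + case=> [<-|//] /=; rewrite ccomp1r zigzagr; exact: (scal_vproj (Wt 0)).
  + case=> [<-|//] /=; rewrite (ccompA (t1 _)) -strand_comp chi_idem chi_trace.
    by apply: scalZ; exact: (scal_vproj (Wt 0)).
  + case=> [|[|//]] <- /=.
      by rewrite jw_strandr cap_jw; exact: scal0.
    rewrite (ccompA (t1 _)) -strand_comp jw_idem ccompA jw_trace; apply: scalN.
    exact: (scal_vproj (Wt 0)).
- case=> [|[|//]] <- l' /=.
    case=> [|[|//]] <- /=; rewrite -ccompA.
      by rewrite jw_strandr cap_jw ccomp0r; exact: scal0.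
    rewrite (ccompA (t1 _)) -strand_comp jw_idem (ccompA (cap _)) jw_trace.
    rewrite ccompNr jw_idem; apply: scalN; exact: (scal_vproj (Wt k.+1)).
  have E : jw k.+1 ** cap k.+2 ** t1 (t1 (jw k.+1) ** cup k.+1) = jw k.+1.
    rewrite -ccompA strand_comp (ccompA (cap _)) cap_natural -ccompA zigzagr.
    by rewrite ccomp1r jw_idem.
  (* The second edge starts at [Wt k], whose list of edges has a different shape when k is 0. *)
  rewrite ccompA {}E; case: k l l' => [|k] l l' /=.
    case=> [|[|[|//]]] <- /=.
    + by rewrite jw_cup; exact: scal0.
    + by rewrite jw_chi; exact: scal0.
    + by rewrite jw_idem; exact: (scal_vproj (Wt 1)).
  case=> [|[|//]] <- /=.
    by rewrite jw_idem; exact: (scal_vproj (Wt k.+2)).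
  by rewrite ccompA jw_strandl jw_cup; exact: scal0.
Qed.

(** The upside-down counterpart of [cap_edges]. *)
Lemma cup_edges v l : List.In l (edges v) ->
  forall l', List.In l' (edges (lv l)) ->
  scal (ld l' ** t1 (ld l) ** (cup (vsize v) ** vproj v)).
Proof.
case: v l => [||[|k]] l /=.
- case=> [<-|//] l' /= [|[|[|//]]] <- /=; rewrite strand1 !ccomp1r.
  + by rewrite ccompZl cap_cup; do 2!apply: scalZ; exact: (scal_vproj Triv).
  + by rewrite chi_cup; exact: scal0.
  + by rewrite jw_cup; exact: scal0.
- have E : t1 (cap 1 ** t1 chi) ** (cup 2 ** chi) = chi.
    rewrite ccompA strand_comp -(ccompA _ _ (cup 2)) cup_natural ccompA zigzagl.
    by rewrite ccomp1l chi_idem.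
  case=> [<-|//] l' /=; rewrite strandZ.
  case=> [|[|[|//]]] <- /=; rewrite -ccompA (ccompZl _ (t1 _)) E ccompZr.
  + by rewrite ccompZl cap_chi !scaler0; exact: scal0.
  + by rewrite chi_idem; apply: scalZ; exact: (scal_vproj Sign).
  + by rewrite jw_chi scaler0; exact: scal0.
- rewrite -[jw 0]/(dia_id 1) ccomp1r; case=> [|[|[|//]]] <- l' /=.
  + case=> [<-|//] /=; rewrite ccomp1l strandZ ccompZl zigzagl; apply: scalZ.
    exact: (scal_vproj (Wt 0)).
  + case=> [<-|//] /=; rewrite !ccompZl -(ccompA (cap 1)) -strand_comp chi_idem.
    rewrite -ccompA chi_trace.
    by do 2!apply: scalZ; exact: (scal_vproj (Wt 0)).
  + case=> [|[|//]] <- /=.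
      by rewrite jw_strandl jw_cup; exact: scal0.
    rewrite ccompNl -(ccompA (cap 1)) -strand_comp jw_idem ccompNl jw_trace.
    by rewrite opprK; exact: (scal_vproj (Wt 0)).
- case=> [|[|//]] <- l' /=.
    case=> [|[|//]] <- /=; rewrite ccompA.
      by rewrite jw_strandl jw_cup ccomp0l; exact: scal0.
    rewrite ccompNl -(ccompA (cap _)) -strand_comp jw_idem ccompNl jw_trace.
    by rewrite opprK jw_idem; exact: (scal_vproj (Wt k.+1)).
  have E : t1 (cap k.+1 ** t1 (jw k.+1)) ** (cup k.+2 ** jw k.+1) = jw k.+1.
    rewrite ccompA strand_comp -(ccompA _ _ (cup _)) cup_natural ccompA zigzagl.
    by rewrite ccomp1l jw_idem.
  rewrite -ccompA strandN ccompNl {}E ccompNr; case: k l l' => [|k] l l' /=.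
    case=> [|[|[|//]]] <- /=.
    + by rewrite ccompZl cap_jw scaler0 oppr0; exact: scal0.
    + by rewrite chi_jw oppr0; exact: scal0.
    + by rewrite jw_idem; apply: scalN; exact: (scal_vproj (Wt 1)).
  case=> [|[|//]] <- /=.
    by rewrite jw_idem; apply: scalN; exact: (scal_vproj (Wt k.+2)).
  by rewrite ccompNl -ccompA jw_strandr cap_jw !oppr0; exact: scal0.
Qed.

Definition ext n (p : leg n) (l : leg (vsize (lv p)).+1) : leg n.+1 :=
  Leg (lv l) (t1 (lu p) ** lu l) (ld l ** t1 (ld p)).

(* Paths of length n from [Triv] in the induction-restriction graph of V. *)
Fixpoint basis n : seq (leg n) :=
  if n is n'.+1 then
    flatten [seq [seq ext l | l <- edges (lv p)] | p <- basis n']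
  else [:: Leg Triv (dia_id 0) (dia_id 0)].

Lemma In_basisS n q : List.In q (basis n.+1) ->
  exists p l, [/\ List.In p (basis n), List.In l (edges (lv p)) & q = ext l].
Proof.
rewrite [basis n.+1]/=; elim: (basis n) => //= p s IH.
rewrite List.in_app_iff.
case=> [/List.in_map_iff [l [<- Hl]]|/IH [p' [l [Hp Hl ->]]]].
  by exists p, l; split=> //; left.
by exists p', l; split=> //; right.
Qed.

Lemma basis_absorb n p : List.In p (basis n) -> lu p ** vproj (lv p) = lu p.
Proof.
case: n p => [|n] p; first by case=> [<-|//] /=; rewrite ccomp1l.
case/In_basisS=> [p0 [l [_ /edgesP [_ _ Hl] ->]]] /=.
by rewrite -ccompA Hl.
Qed.

Lemma basis_complete n : dia_id n = \sum_(p <- basis n) lu p ** ld p.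
Proof.
elim: n => [|n IH]; first by rewrite /= big_cons big_nil addr0 ccomp1l.
rewrite -strand1 IH [basis n.+1]/=.
have: forall p, List.In p (basis n) -> lu p ** vproj (lv p) = lu p.
  exact: basis_absorb.
elim: (basis n) {IH} => [_|p s IH H]; first by rewrite /= !big_nil strand0.
rewrite /= big_cons big_cat strandD big_map /= IH; last first.
  by move=> q Hq; apply: H; right.
(* Inserting the vertex idempotent between the two halves of the path makes [edges_complete]
   applicable. *)
congr (_ + _); rewrite -{1}(H p); last by left.
rewrite !strand_comp edges_complete -ccompA ccomp_suml ccomp_sumr.
by apply: eq_bigr => l _; rewrite !ccompA.
Qed.

(** Schur's lemma for [h], read on its matrix entries between paths: entries between different
    endpoints vanish and the others are scalars. *)
Definition diag m n (h : DH m n) : Prop :=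
  forall p q, List.In p (basis m) -> List.In q (basis n) ->
  scal (ld q ** h ** lu p).

Lemma diag0 m n : diag (0 : DH m n).
Proof. by move=> p q _ _; rewrite ccomp0r ccomp0l; apply: scal0. Qed.

Lemma diagD m n (h h' : DH m n) : diag h -> diag h' -> diag (h + h').
Proof.
move=> H H' p q Hp Hq; rewrite ccompDr ccompDl.
by apply: scalD; [apply: H | apply: H'].
Qed.

Lemma diagZ m n a (h : DH m n) : diag h -> diag (a *: h).
Proof.
by move=> H p q Hp Hq; rewrite ccompZr ccompZl; apply: scalZ; apply: H.
Qed.

Lemma scal_sum v w (I : Type) (s : seq I) (F : I -> DH (vsize v) (vsize w)) :
  (forall i, List.In i s -> scal (F i)) -> scal (\sum_(i <- s) F i).
Proof.
elim: s => [|i s IH] H; first by rewrite big_nil; apply: scal0.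
rewrite big_cons; apply: scalD; first by apply: H; left.
by apply: IH => j Hj; apply: H; right.
Qed.

(** Matrix multiplication: the resolution of the identity into paths is inserted between [g] and
    [h]. *)
Lemma diag_comp m n p (g : DH n p) (h : DH m n) :
  diag g -> diag h -> diag (g ** h).
Proof.
move=> G H x y Hx Hy; rewrite -[g]ccomp1r basis_complete.
rewrite ccomp_sumr ccomp_suml ccomp_sumr ccomp_suml; apply: scal_sum => z Hz.
rewrite !ccompA -!(ccompA _ (ld z)) -(ccompA _ (ld z ** _)).
by apply: scal_comp; [apply: G | apply: H].
Qed.

(** The entry for the paths without their last edges is a scalar, which reduces the new entry to a
    composite of two edges at the same vertex. *)
Lemma diag_strand m n (h : DH m n) : diag h -> diag (t1 h).
Proof.
move=> H p q /In_basisS[p0 [l [Hp Hl ->]]] /In_basisS[q0 [l' [Hq Hl' ->]]] /=.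
rewrite !ccompA -(ccompA (ld l')) -strand_comp -(ccompA (ld l')) -strand_comp.
have [a ->] := H _ _ Hp Hq; rewrite strandZ ccompZr ccompZl; apply: scalZ.
have [e|->] := vhomP (lv p0) (lv q0); last first.
  by rewrite strand0 ccomp0r ccomp0l; apply: scal0.
move: l' Hl'; rewrite -e vhomxx => l' Hl'; have [_ -> _] := edgesP Hl'.
exact: edges_orth.
Qed.

(** Orthogonality of paths comes from [diag_strand], as the identity on n strands is an iterated
    strand. *)
Lemma diag1 n : diag (dia_id n).
Proof.
elim: n => [|n IH]; last by rewrite -strand1; apply: diag_strand.
move=> p q [<-|//] [<-|//] /=; rewrite !ccomp1l; exact: (scal_vproj Triv).
Qed.

Lemma diag_strands c m n (h : DH m n) : diag h -> diag (strands c h).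
Proof. by move=> H; elim: c => //= c IH; apply: diag_strand. Qed.

Lemma diag_heq m n m' n' (h : DH m n) (h' : DH m' n') :
  heq h h' -> diag h -> diag h'.
Proof.
by case=> em [en]; case: _ / em h' => h'; case: _ / en h' => h' <-.
Qed.

(** By naturality the cap slides past all but the last two edges, leaving the local computation
    [cap_edges]. *)
Lemma diag_cap n : diag (cap n).
Proof.
move=> p q /In_basisS[p1 [l' [H1 Hl' ->]]] Hq; move: l' Hl'.
case/In_basisS: H1 => p0 [l [Hp Hl ->]] /= l' Hl'.
rewrite strand_comp !ccompA -(ccompA _ (cap n)) cap_natural ccompA.
have [a] := diag1 Hp Hq; rewrite ccomp1r => ->.
rewrite !ccompZl; apply: scalZ; have [e|->] := vhomP (lv p0) (lv q); last first.
  by rewrite !ccomp0l; apply: scal0.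
by case: _ / e; rewrite vhomxx -ccompA; apply: cap_edges.
Qed.

Lemma diag_cup n : diag (cup n).
Proof.
move=> p q Hp /In_basisS[q1 [l' [H1 Hl' ->]]]; move: l' Hl'.
case/In_basisS: H1 => q0 [l [Hq Hl ->]] /= l' Hl'.
rewrite strand_comp -!ccompA (ccompA (t1 (t1 _))) cup_natural -ccompA.
have [a] := diag1 Hp Hq; rewrite ccomp1r => ->.
rewrite !ccompZr; apply: scalZ; have [e|->] := vhomP (lv p) (lv q0); last first.
  by rewrite !ccomp0r; apply: scal0.
by rewrite e vhomxx ccompA; apply: cup_edges.
Qed.

Lemma diag_leg n (p : leg n) : List.In p (basis n) -> diag (lu p ** ld p).
Proof.
move=> Hp x y Hx Hy; rewrite ccompA -(ccompA _ (ld p)); apply: scal_comp.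
  by have := diag1 Hp Hy; rewrite ccomp1r.
by have := diag1 Hx Hp; rewrite ccomp1r.
Qed.

(** Up to the factor -2, [D] is the projection belonging to the path from [Triv] through [Wt 0] to
    [Sign]. *)
Lemma diag_dcc : diag D.
Proof.
pose p := @ext 1
  (@ext 0 (Leg Triv (dia_id 0) (dia_id 0)) (Leg (Wt 0) (dia_id 1) (dia_id 1)))
  (Leg Sign chi chi).
have Hp : List.In p (basis 2) by right; left.
have -> : D = - 2 *: (lu p ** ld p).
  rewrite /= ccomp1r ccomp1l !strand1 ccomp1l ccomp1r chi_idem /chi scalerA.
  by rewrite mulrNN mulfV // scale1r.
exact: diagZ (diag_leg Hp).
Qed.

(** Undecorated terms occur to the right of arbitrarily many strands, so for them the induction has
    to cover the action on every object. *)
Definition diag_kind k m n : DHom R k m n -> Prop :=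
  match k with
  | TL => fun u => forall a, diag (act a u)
  | DiTL => fun u => diag u
  end.

Lemma diag_cls k m n (f : dia R k m n) : diag_kind (cls f).
Proof.
elim: f => {k m n}.
- by move=> [] n => [a|]; rewrite cls_Id ?act1; apply: diag1.
- move=> [] m n p f IHf g IHg => [a|]; rewrite -ccompE ?act_comp;
    by apply: diag_comp.
- by move=> [] m n => [a|]; rewrite cls_Zero ?act_0; apply: diag0.
- by move=> [] m n f IHf g IHg => [a|]; rewrite cls_Add ?actD; apply: diagD.
- by move=> [] m n z f IHf => [a|]; rewrite cls_Scale ?actZ; apply: diagZ.
- move=> [] a b c d f IHf g IHg => [e|]; rewrite -ctensE.
    apply: diag_heq (heq_sym (act_tens _ _ _)) _.
    by apply: diag_comp (IHg _) _; apply: diag_strands; exact: IHf.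
  apply: diag_heq (heq_sym (ctens_act _ _)) _.
  by apply: diag_comp (IHg _) _; apply: diag_strands; exact: IHf.
- exact: diag_cap.
- exact: diag_cup.
- exact: diag_dcc.
Qed.

Lemma diag_all m n (u : DH m n) : diag u.
Proof. by rewrite -[u]clsK; exact: (@diag_cls DiTL m n (repr u)). Qed.
End PathBasis.

(** * Values of the functor *)

Section Semantics.
Variable R : realType.
Local Notation C := R[i].
Local Notation DH := (DHom R DiTL).
Local Infix "**" := (@ccomp R _ _ _ _) (at level 40, left associativity).
Local Notation tpow := (@tpow R).
Local Notation ket s := (tbas R (wseq _ s)).

Definition semh m n (u : DH m n) : 'Hom(tpow m, tpow n) := sem (repr u).

Lemma semh_cls m n (f : dia R DiTL m n) : semh (cls f) = sem f.
Proof. exact/sem_deq/reprP. Qed.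

Lemma semh_comp m n p (u : DH n p) (v : DH m n) :
  semh (u ** v) = (semh u \o semh v)%VF.
Proof. by rewrite -[u]clsK -[v]clsK ccompE !semh_cls. Qed.

Lemma semhD m n (u v : DH m n) : semh (u + v) = semh u + semh v.
Proof. by rewrite -[u]clsK -[v]clsK -cls_Add !semh_cls. Qed.

Lemma semhZ m n a (u : DH m n) : semh (a *: u) = a *: semh u.
Proof. by rewrite -[u]clsK -cls_Scale !semh_cls. Qed.

Lemma semh0 m n : semh (0 : DH m n) = 0.
Proof. exact: (semh_cls (Zero R DiTL m n)). Qed.

Lemma semh1 n : semh (dia_id R DiTL n) = \1%VF.
Proof. exact: semh_cls. Qed.

Lemma semhB m n (u v : DH m n) : semh (u - v) = semh u - semh v.
Proof. by rewrite -[- v]scaleN1r semhD semhZ scaleN1r. Qed.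

Definition castV m n m' n' (em : m = m') (en : n = n')
    (f : 'Hom(tpow m, tpow n)) : 'Hom(tpow m', tpow n') :=
  ecast q ('Hom(tpow m', tpow q)) en (ecast p ('Hom(tpow p, tpow n)) em f).

Lemma sem_dcastV k m n m' n' (em : m = m') (en : n = n') (f : dia R k m n) :
  sem (dcast em en f) = castV em en (sem f).
Proof. by case: _ / em; case: _ / en. Qed.

Lemma castV_comp m n p m' n' p' (em : m = m') (en : n = n') (ep : p = p')
    (f : 'Hom(tpow n, tpow p)) (g : 'Hom(tpow m, tpow n)) :
  castV em ep (f \o g)%VF = (castV en ep f \o castV em en g)%VF.
Proof. by case: _ / em; case: _ / en; case: _ / ep. Qed.

Lemma castV_tact m m' (em : m = m') g : castV em em (tact m g) = tact m' g.
Proof. by case: _ / em. Qed.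

Definition strandV m n (f : 'Hom(tpow m, tpow n)) :
    'Hom(tpow m.+1, tpow n.+1) :=
  castV (addn1 m) (addn1 n) (tmap f (\1 : 'End(tpow 1))).

Lemma semh_strand m n (u : DH m n) : semh (strand u) = strandV (semh u).
Proof. by rewrite /strand -{1}[u]clsK ctensE hcast_cls semh_cls sem_dcastV. Qed.

Lemma strandV0 m n : strandV (0 : 'Hom(tpow m, tpow n)) = 0.
Proof. by rewrite -semh0 -semh_strand strand0 semh0. Qed.

Lemma strandV_comp m n p (f : 'Hom(tpow n, tpow p)) (g : 'Hom(tpow m, tpow n)) :
  strandV (f \o g)%VF = (strandV f \o strandV g)%VF.
Proof.
rewrite /strandV -(castV_comp _ _ (addn1 p)) -tmap_comp.
by rewrite comp_lfun1l.
Qed.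

Lemma strandV_tact m n g (f : 'Hom(tpow m, tpow n)) :
  (f \o tact m g = tact n g \o f)%VF ->
  (strandV f \o tact m.+1 g = tact n.+1 g \o strandV f)%VF.
Proof.
move=> fg; rewrite -(castV_tact (addn1 m)) -(castV_tact (addn1 n)) /strandV.
rewrite -!castV_comp !tact_tmap -!tmap_comp fg.
by rewrite comp_lfun1l comp_lfun1r.
Qed.

(** Vectors as lists of coefficients and words: tensoring with a basis vector becomes concatenation,
    and casts between tensor powers leave the list unchanged. *)
Definition ketsum n (L : seq (C * seq 'I_2)) : tpow n :=
  \sum_(p <- L) p.1 *: ket p.2.

Lemma ketsum_cons n p L : ketsum n (p :: L) = p.1 *: ket p.2 + ketsum n L.
Proof. exact: big_cons. Qed.

Lemma ketsum_nil n : ketsum n [::] = 0.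
Proof. exact: big_nil. Qed.

Lemma ketsum1 n a s : ketsum n [:: (a, s)] = a *: ket s.
Proof. exact: big_seq1. Qed.

Lemma tmul_ketsuml a b L t : all (fun p => size p.2 == a) L -> size t = b ->
  tmul (ketsum a L) (ket t : tpow b) =
  ketsum (a + b) [seq (p.1, p.2 ++ t) | p <- L].
Proof.
move=> HL Ht; elim: L HL => [|[z s] L IH] HL.
  by rewrite !ketsum_nil; exact: tmul0l.
have {HL} [/eqP Hs HL] := andP HL; rewrite map_cons !ketsum_cons.
apply: etrans (tmulDl _ _ _) _; apply: (congr2 +%R); last exact: IH.
apply: etrans (tmulZl _ _ _) _; apply: (congr1 ( *:%R z)); exact: tmul_bas.
Qed.

Lemma tmul_ketsumr a b L t : all (fun p => size p.2 == b) L -> size t = a ->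
  tmul (ket t : tpow a) (ketsum b L) =
  ketsum (a + b) [seq (p.1, t ++ p.2) | p <- L].
Proof.
move=> HL Ht; elim: L HL => [|[z s] L IH] HL.
  by rewrite !ketsum_nil; exact: tmul0r.
have {HL} [/eqP Hs HL] := andP HL; rewrite map_cons !ketsum_cons.
apply: etrans (tmulDr _ _ _) _; apply: (congr2 +%R); last exact: IH.
apply: etrans (tmulZr _ _ _) _; apply: (congr1 ( *:%R z)); exact: tmul_bas.
Qed.

Lemma ketsum_all n (v : tpow n) :
  exists2 L, v = ketsum n L & all (fun p => size p.2 == n) L.
Proof.
exists [seq (v w : C, wlist w) | w <- enum {: word n}]; last first.
  by apply/allP => _ /mapP[w _ ->] /=; rewrite size_wlist.
rewrite /ketsum big_map big_enum /= {1}(tpow_sum v).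
by apply: eq_bigr => w _; rewrite wlistK.
Qed.

Lemma castV_ketsum m n m' n' (em : m = m') (en : n = n')
    (f : 'Hom(tpow m, tpow n)) s L :
  f (ket s) = ketsum n L -> castV em en f (ket s) = ketsum n' L.
Proof. by case: _ / em; case: _ / en. Qed.

Lemma strandV_ketsum m n (f : 'Hom(tpow m, tpow n)) s i L :
    size s = m -> all (fun p => size p.2 == n) L -> f (ket s) = ketsum n L ->
  strandV f (ket (s ++ [:: i])) =
  ketsum n.+1 [seq (p.1, p.2 ++ [:: i]) | p <- L].
Proof.
move=> Hs HL fs; apply: castV_ketsum; rewrite tmap_bas // fs id_lfunE.
exact: tmul_ketsuml.
Qed.

Lemma semh_act a c d (g : dia R TL c d) (s t : seq 'I_2) L :
    size s = a -> size t = c -> all (fun p => size p.2 == d) L ->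
    sem g (ket t) = ketsum d L ->
  semh (act a (cls g)) (ket (s ++ t)) =
  ketsum (d + a) [seq (p.1, s ++ p.2) | p <- L].
Proof.
move=> Hs Ht HL gt; rewrite /act ctensE hcast_cls semh_cls sem_dcastV.
apply: castV_ketsum; rewrite tmap_bas // gt id_lfunE.
exact: tmul_ketsumr.
Qed.

Lemma semh_cap a s i j : size s = a ->
  semh (cap R a) (ket (s ++ [:: i; j])) = eps R i j *: ket s.
Proof.
move=> Hs.
have E : sem (Ev R) (ket [:: i; j]) = ketsum 0 [:: (eps R i j, [::])].
  by rewrite ketsum1; exact: ev_eps.
have := semh_act Hs (erefl : size [:: i; j] = 2) _ E; move/(_ isT).
by rewrite /= ketsum1 cats0.
Qed.

Lemma semh_cup a s : size s = a ->
  semh (cup R a) (ket s) = ket (s ++ [:: 1; 0]) - ket (s ++ [:: 0; 1]).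
Proof.
move=> Hs; rewrite -{1}[s]cats0.
have E : sem (Coev R) (ket [::]) =
    ketsum 2 [:: (1, [:: 1; 0]); (-1, [:: 0; 1])].
  by rewrite ketsum_cons ketsum1 /= scale1r scaleN1r; exact: coev_bas.
have := semh_act Hs (erefl : size [::] = 0) _ E; move/(_ isT).
by rewrite /= ketsum_cons ketsum1 scale1r scaleN1r.
Qed.

Lemma ket_ext m (W : vectType C) (f g : 'Hom(tpow m, W)) :
  (forall s, size s = m -> f (ket s) = g (ket s)) -> f = g.
Proof.
by move=> fg; apply: tpow_hom_ext => w; rewrite -[w]wlistK fg ?size_wlist.
Qed.

Lemma linear_ketsum n (W : vectType C) (f : 'Hom(tpow n, W)) L :
  f (ketsum n L) = \sum_(p <- L) p.1 *: f (ket p.2).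
Proof.
rewrite /ketsum linear_sum; apply: eq_bigr => p _; exact: linearZ.
Qed.

(** Naturality of the cap for arbitrary linear maps. Fullness needs it for maps not yet known to
    come from diagrams. *)
Lemma cap_strandV m n (f : 'Hom(tpow m, tpow n)) :
  (semh (cap R n) \o strandV (strandV f))%VF = (f \o semh (cap R m))%VF.
Proof.
apply: ket_ext => s'; case/lastP: s' => // s' j; rewrite size_rcons => -[].
case/lastP: s' => // s i; rewrite size_rcons => -[Hs].
rewrite -!cats1 !comp_lfunE -[in RHS]catA semh_cap // linearZ /=.
have [L fs HL] := ketsum_all (f (ket s)).
have E1 := strandV_ketsum i Hs HL fs.
have HL1 : all (fun p => size p.2 == n.+1) [seq (p.1, p.2 ++ [:: i]) | p <- L].
  by rewrite all_map; apply: sub_all HL => p /= /eqP <-; rewrite size_cat addn1.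
have Hs1 : size (s ++ [:: i]) = m.+1 by rewrite size_cat Hs addn1.
rewrite (strandV_ketsum j Hs1 HL1 E1) fs linear_ketsum !big_map.
rewrite /ketsum scaler_sumr !big_seq; apply: eq_bigr => p Hp.
have /eqP Hp2 := allP HL p Hp; cbn [fst snd].
by rewrite -catA (semh_cap _ _ Hp2) scalerA [RHS]scalerA mulrC.
Qed.

Lemma semh_dcc i j : semh (dcc R) (ket [:: i; j]) =
  if i != j then - (ket [:: 0; 1] + ket [:: 1; 0]) else 0.
Proof. by rewrite semh_cls; exact: e1_bas. Qed.

Lemma semh_cupcap a s i j : size s = a ->
  semh (cupcap R a) (ket (s ++ [:: i; j])) =
  eps R i j *: (ket (s ++ [:: 1; 0]) - ket (s ++ [:: 0; 1])).
Proof.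
by move=> Hs; rewrite semh_comp comp_lfunE semh_cap // linearZ /= semh_cup.
Qed.

End Semantics.

(** * Invariant vectors *)

Section Invariants.
Variables (R : realType) (theta : R).
Local Notation C := R[i].
Local Notation DH := (DHom R DiTL).
Local Infix "**" := (@ccomp R _ _ _ _) (at level 40, left associativity).
Local Notation tpow := (@tpow R).
Local Notation ket s := (tbas R (wseq _ s)).

Let two_unit : (2 : C) != 0. Proof. by rewrite pnatr_eq0. Qed.

Let lfunZ m n (f : 'Hom(tpow m, tpow n)) a v : f (a *: v) = a *: f v.
Proof. exact: linearZ. Qed.
Let lfunB m n (f : 'Hom(tpow m, tpow n)) u v : f (u - v) = f u - f v.
Proof. exact: linearB. Qed.

Lemma semh_strand_jw k s i : size s = k.+1 ->
    semh (jw R k) (ket s) = (constant s)%:R *: ket s ->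
  semh (strand (jw R k)) (ket (s ++ [:: i])) =
  (constant s)%:R *: ket (s ++ [:: i]).
Proof.
move=> Hs; rewrite -ketsum1 => Es; rewrite semh_strand.
rewrite (strandV_ketsum i Hs _ Es) /= ?Hs ?eqxx //.
exact: ketsum1.
Qed.

(** The stranded projection does not see the last letter. Among the words it fixes, the cup-cap term
    cancels exactly those whose last letter differs from the rest. *)
Lemma semh_jw k s : size s = k.+1 ->
  semh (jw R k) (ket s) = (constant s)%:R *: ket s.
Proof.
elim: k s => [|[|k] IH] s.
- by case: s => [|i []] // _; rewrite semh1 id_lfunE scale1r.
- case: s => [|i [|j []]] // _.
  have -> : jw R 1 = dia_id R DiTL 2 + 2^-1 *: (dcc R + cupcap R 0) by [].
  rewrite semhD semhZ semhD semh1 add_lfunE scale_lfunE add_lfunE id_lfunE.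
  rewrite semh_dcc (@semh_cupcap _ 0 [::]) //.
  have -> : constant [:: i; j] = (j == i) by rewrite /= andbT.
  rewrite /eps !cat0s; case: (I2P i) => ->; case: (I2P j) => -> /=.
  + by rewrite scale0r !addr0 scaler0 addr0 scale1r.
  + rewrite scale1r scale0r opprD -addrA addKr -opprD -mulr2n.
    rewrite -[ket _ *+ 2]scaler_nat.
    by rewrite scalerN scalerA mulVf // scale1r subrr.
  + rewrite scaleN1r scale0r opprB [ket _ + ket _]addrC opprD -addrA addKr.
    rewrite -opprD -mulr2n -[ket _ *+ 2]scaler_nat.
    by rewrite scalerN scalerA mulVf // scale1r subrr.
  + by rewrite scale0r !addr0 scaler0 addr0 scale1r.
- case: s => [//|x s'] [Hs']; have [r [t [-> Hr Ht]]] : exists r t,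
      [/\ s' = r ++ t, size r = k & size t = 2].
    apply: size_catP; by rewrite Hs' addn2.
  case: t Ht => [|i [|j []]] // _.
  pose c := all (pred1 x) r.
  have P a b : semh (strand (jw R k.+1)) (ket (x :: r ++ [:: a; b])) =
      (c && (a == x))%:R *: ket (x :: r ++ [:: a; b]).
    have -> : x :: r ++ [:: a; b] = (x :: r ++ [:: a]) ++ [:: b].
      by rewrite /= -catA.
    have Hs : size (x :: r ++ [:: a]) = k.+2 by rewrite /= size_cat Hr addn1.
    by rewrite (semh_strand_jw _ Hs (IH _ Hs)) /= all_cat /= andbT.
  have HU a b : semh (cupcap R k.+1) (ket (x :: r ++ [:: a; b])) =
      eps R a b *: (ket (x :: r ++ [:: 1; 0]) - ket (x :: r ++ [:: 0; 1])).
    by apply: (@semh_cupcap _ k.+1 (x :: r)); rewrite /= Hr.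
  rewrite jwSS semhD (semh_comp (strand _ ** _)) (semh_comp (strand _)).
  rewrite add_lfunE !comp_lfunE P 2!lfunZ HU lfunZ lfunB !P /= all_cat.
  rewrite -/c /= andbT.
  rewrite /eps; case: c P => _ /=; last by rewrite !scale0r addr0.
  case: (I2P i) => ->; case: (I2P j) => ->; case: (I2P x) => -> /=;
    rewrite ?scale0r ?scale1r ?scaler0 ?addr0 ?sub0r ?subr0 ?scaleN1r
      ?scaler0 ?subrr //.
Qed.

(** * Powers of the eigenvalues of the rotation *)

Lemma de_moivre (x : R) n :
  (cos x +i* sin x)%C ^+ n = (cos (x *+ n) +i* sin (x *+ n))%C.
Proof.
elim: n => [|n IH]; first by rewrite expr0 mulr0n cos0 sin0.
by rewrite exprS IH mulrS cosD sinD; simpc; rewrite [sin x * _ + _]addrC.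
Qed.

(** With m the floor of [x / pi], a nonzero remainder would lie strictly between 0 and [pi], where
    the sine is positive. *)
Lemma sin_eq0_rational (x : R) : sin x = 0 -> exists m : int, x = m%:~R * pi.
Proof.
move=> sx; have pi0 := pi_gt0 R.
have /andP[] := floor_itv (x / pi); move: (Num.floor _) => m.
rewrite ler_pdivlMr // ltr_pdivrMr // intrD mulrDl mul1r => mx xm.
exists m; apply/eqP; rewrite eq_le mx andbT leNgt; apply/negP => m_lt_x.
have sn k : sin (k%:R * pi : R) = 0.
  by rewrite mulr_natl -[pi *+ k]add0r (alternatingn (@sinDpi R)) sin0 mulr0.
have sm : sin (m%:~R * pi : R) = 0.
  case: m {mx xm m_lt_x} => k; first by rewrite -pmulrn sn.
  by rewrite NegzE mulrNz mulNr sinN sn oppr0.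
have := @sin_gt0_pi R (x - m%:~R * pi); rewrite subr_gt0 m_lt_x ltrBlDl xm.
by rewrite sinB sx sm mul0r mulr0 subrr ltxx => /(_ isT).
Qed.

(** An n-th power equal to 1 has vanishing imaginary part, which would make n times theta an integer
    multiple of [pi]. *)
Lemma rotation_aperiodic n : irrational (theta / pi) -> (0 < n)%N ->
  (cos theta +i* sin theta)%C ^+ n != 1.
Proof.
move=> theta_irr n0; apply/eqP; rewrite de_moivre => -[_].
case/sin_eq0_rational => m E; apply: theta_irr; apply/rationalP; exists m, n.
have pi0 : (pi : R) != 0 by rewrite gt_eqF ?pi_gt0.
have n1 : (n%:R : R) != 0 by rewrite pnatr_eq0 -lt0n.
by apply/eqP; rewrite eqr_div // mulr_natr E.
Qed.

Lemma dic_a_aperiodic i n : irrational (theta / pi) -> (0 < n)%N ->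
  dic_a theta i i ^+ n != 1.
Proof.
move=> theta_irr n0; have z1 := rotation_aperiodic theta_irr n0.
have -> : dic_a theta i i =
    if i == 0 then (cos theta +i* sin theta)%C else (cos theta -i* sin theta)%C.
  by rewrite mxE eqxx.
case: (I2P i) => ->; first exact: z1.
apply: contra z1 => /eqP E.
have -> : (cos theta +i* sin theta)%C = conjc (cos theta -i* sin theta)%C.
  by rewrite /= opprK.
by rewrite -rmorphXn /= E conjc1.
Qed.

Lemma tact_dic_a n (w : word n) :
  tact n (dic_a theta) (tbas R w) =
  (\prod_i dic_a theta (w i) (w i)) *: tbas R w.
Proof.
rewrite tact_tbas; apply/ffunP => w'.
apply: etrans (ffunE _ _) _; apply: esym; apply: etrans (ffunE _ _) _.
apply: etrans (congr1 _ (ffunE _ _)) _; case: eqP => [->|/eqP nw].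
  exact: mulr1.
have [i ni] : exists i, w' i != w i.
  apply/existsP; apply: contraNT nw; rewrite negb_exists => /forallP H.
  by apply/eqP/ffunP => i; apply/eqP; rewrite -[_ == _]negbK.
by rewrite [RHS](bigD1 i) //= [dic_a _ (w' i) _]mxE ni mul0r; exact: mulr0.
Qed.

Lemma tpow_coefE n (c : word n -> C) w :
  (\sum_w' c w' *: tbas R w' : tpow n) w = c w.
Proof.
rewrite tpow_sumE (bigD1 w) //= big1 ?addr0 => [|w' nw].
  by apply: etrans (ffunE _ _) _; rewrite ffunE eqxx; exact: mulr1.
apply: etrans (ffunE _ _) _; rewrite ffunE eq_sym (negPf nw); exact: mulr0.
Qed.

Lemma diagonal_fixed n (f : 'End(tpow n)) (c : word n -> C) (v : tpow n) w :
  (forall w, f (tbas R w) = c w *: tbas R w) -> f v = v -> v w = v w * c w :> C.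
Proof.
move=> fE fv.
have E : v = \sum_w' ((v w' : C) * c w') *: tbas R w'.
  rewrite -{1}fv {1}(tpow_sum v) linear_sum; apply: eq_bigr => w' _.
  by rewrite -scalerA -fE; exact: linearZ.
by rewrite {1}E; exact: (tpow_coefE (fun w' => (v w' : C) * c w')).
Qed.

Lemma constant_nth (s : seq 'I_2) : constant s -> s = nseq (size s) (head 0 s).
Proof. by case: s => //= i s /all_pred1P {1}->. Qed.

(** The projection leaves only the coefficients of constant words. There the rotation acts by the
    (k+1)st power of one diagonal entry, which is not 1. *)
Lemma fixed_Wt k (v : tpow k.+1) : irrational (theta / pi) ->
  tact k.+1 (dic_a theta) v = v -> semh (jw R k) v = v -> v = 0.
Proof.
move=> theta_irr av jv; apply/ffunP => w; rewrite [RHS]ffunE.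
have jE u : semh (jw R k) (tbas R u) = (constant (wlist u))%:R *: tbas R u.
  by have := semh_jw (size_wlist u); rewrite wlistK.
have := diagonal_fixed w jE jv.
case: (boolP (constant (wlist w))) => [cw _|_ ->]; last exact: mulr0.
have wE i : w i = head 0 (wlist w).
  rewrite -{1}[w]wlistK ffunE {1}(constant_nth cw) nth_nseq size_wlist.
  by rewrite ltn_ord.
have := diagonal_fixed w (@tact_dic_a _) av.
rewrite (eq_bigr (fun=> dic_a theta (head 0 (wlist w)) (head 0 (wlist w)))).
  rewrite prodr_const card_ord => /eqP.
  rewrite -[X in X == _]mulr1 -subr_eq0 -mulrBr mulf_eq0 => /orP[/eqP //|].
  rewrite subr_eq0 eq_sym => E.
  by have := dic_a_aperiodic (head 0 (wlist w)) theta_irr (ltn0Sn k); rewrite E.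
by move=> i _; rewrite wE.
Qed.

Let lin4_2 (W : lmodType C) a (u1 u2 u3 u4 : W) :
  0 *: u1 + a *: u2 + (0 *: u3 + 0 *: u4) = a *: u2.
Proof. by rewrite !scale0r add0r !addr0. Qed.
Let lin4_3 (W : lmodType C) a (u1 u2 u3 u4 : W) :
  0 *: u1 + 0 *: u2 + (a *: u3 + 0 *: u4) = a *: u3.
Proof. by rewrite !scale0r !add0r addr0. Qed.

(** The image of [chi] is the line through the symmetric tensor [q], and [dic_x] negates [q]. *)
Lemma fixed_Sign (v : tpow 2) :
  tact 2 (dic_x R) v = v -> semh (chi R) v = v -> v = 0.
Proof.
move=> xv cv; pose q : tpow 2 := ket [:: 0; 1] + ket [:: 1; 0].
have [c vE] : exists c : C, v = c *: q.
  rewrite -cv /chi semhZ scale_lfunE; have [L -> HL] := ketsum_all v.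
  rewrite linear_ketsum; elim: L HL => [|[a s] L IH] HL.
    by exists 0; rewrite big_nil scaler0 scale0r.
  have {HL} [/eqP Hs HL] := andP HL; have [b Eb] := IH HL.
  rewrite big_cons scalerDr {}Eb; case: s Hs => [|i [|j []]] // _.
  cbn [fst snd]; rewrite semh_dcc; case: ifP => _; last first.
    by exists b; rewrite !scaler0 add0r.
  by exists (- (- 2^-1 * a) + b); rewrite !scalerN scalerA scalerDl scaleNr.
have x00 : dic_x R 0 0 = 0 by rewrite mxE.
have x01 : dic_x R 0 1 = -1 by rewrite mxE.
have x10 : dic_x R 1 0 = 1 by rewrite mxE.
have x11 : dic_x R 1 1 = 0 by rewrite mxE.
have x_ket01 : tact 2 (dic_x R) (ket [:: 0; 1]) = - ket [:: 1; 0] :> tpow 2.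
  apply: etrans (tact_ket2E _ _ _) _.
  rewrite x00 x01 x10 x11 !mul0r !mulr0 mul1r.
  by rewrite lin4_3 scaleN1r.
have x_ket10 : tact 2 (dic_x R) (ket [:: 1; 0]) = - ket [:: 0; 1] :> tpow 2.
  apply: etrans (tact_ket2E _ _ _) _.
  rewrite x00 x01 x10 x11 !mul0r !mulr0 mulr1.
  by rewrite lin4_2 scaleN1r.
have xq : tact 2 (dic_x R) q = - q.
  by rewrite /q linearD /= x_ket01 x_ket10 opprD addrC.
move: xv; rewrite vE lfunZ xq scalerN => E.
have : (2 : C) *: (c *: q) = 0 by rewrite scaler_nat mulr2n -{1}E addNr.
by move/eqP; rewrite scaler_eq0 (negPf two_unit) => /eqP.
Qed.

(** A map out of the trivial representation is given by an invariant vector. At [Triv] it is a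
    scalar; at the other vertices the vector is zero. *)
Lemma invariant_scal v (f : 'Hom(tpow 0, tpow (vsize v))) :
    irrational (theta / pi) ->
    f \in @equivariant R theta (Vpow theta 0) (Vpow theta (vsize v)) ->
    (semh (vproj R v) \o f)%VF = f ->
  exists u : DH 0 (vsize v), semh u = f.
Proof.
move=> theta_irr /asboolP fG pf.
have fixed g : Dic theta g -> tact (vsize v) g (f (ket [::])) = f (ket [::]).
  move=> /fG /= /(congr1 (fun h : 'Hom(tpow 0, tpow _) => h (ket [::]))).
  by rewrite /= tact0 comp_lfun1r comp_lfunE.
have pfixed : semh (vproj R v) (f (ket [::])) = f (ket [::]).
  by rewrite -{2}pf comp_lfunE.
have f0 : f (ket [::]) = 0 -> exists u : DH 0 (vsize v), semh u = f.
  move=> E; exists 0; rewrite semh0; apply: ket_ext => s /size0nil ->.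
  by rewrite E zero_lfunE.
case: v f fG pf fixed pfixed f0 => [||k] f _ _ fixed pfixed f0.
- exists ((f (ket [::]) (wseq 0 [::]) : C) *: dia_id R DiTL 0).
  rewrite semhZ semh1; apply: ket_ext => s /size0nil ->.
  rewrite scale_lfunE id_lfunE; apply/ffunP => w.
  have -> : w = wseq 0 [::] by apply/ffunP => -[].
  by apply: etrans (ffunE _ _) _; rewrite ffunE eqxx; exact: mulr1.
- by apply/f0/fixed_Sign => //; apply: fixed; exact: Dic_x.
- by apply/f0/fixed_Wt => //; apply: fixed; exact: Dic_a.
Qed.
End Invariants.

(** * Full faithfulness *)

Section FullyFaithful.
Variables (R : realType) (theta : R).
Local Notation C := R[i].
Local Notation DH := (DHom R DiTL).
Local Infix "**" := (@ccomp R _ _ _ _) (at level 40, left associativity).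
Local Notation tpow := (@tpow R).
Local Notation ket s := (tbas R (wseq _ s)).
Local Notation GHom m n := (@equivariant R theta (Vpow theta m) (Vpow theta n)).

Lemma semh_equivariant m n (u : DH m n) : semh u \in GHom m n.
Proof. exact: sem_equivariant. Qed.

Lemma equivariant_compV m n p (f : 'Hom(tpow n, tpow p))
    (g : 'Hom(tpow m, tpow n)) :
  f \in GHom n p -> g \in GHom m n -> (f \o g)%VF \in GHom m p.
Proof.
by move=> Hf Hg; exact: (equivariant_comp (Intertwiner Hf) (Intertwiner Hg)).
Qed.

Lemma strandV_equivariant m n (f : 'Hom(tpow m, tpow n)) :
  f \in GHom m n -> strandV f \in GHom m.+1 n.+1.
Proof.
by move=> /asboolP fG; apply/asboolP => g Dg; apply: strandV_tact; apply: fG.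
Qed.

Lemma semh_suml (I : Type) (s : seq I) m n (F : I -> DH m n) :
  semh (\sum_(i <- s) F i) = \sum_(i <- s) semh (F i).
Proof.
elim: s => [|i s IH]; first by rewrite !big_nil semh0.
by rewrite !big_cons semhD IH.
Qed.

Lemma lone_neq0 n : (\1%VF : 'End(tpow n)) != 0.
Proof.
(* [wseq n [::]] is the all-zero word, by the default value of [nth]. *)
apply/eqP => /lfunP /(_ (ket [::])); rewrite id_lfunE zero_lfunE.
move/ffunP/(_ (wseq n [::])); rewrite !ffunE eqxx; exact/eqP/oner_neq0.
Qed.

Lemma In_Triv :
  List.In (@Leg R 0 Triv (dia_id R DiTL 0) (dia_id R DiTL 0)) (basis R 0).
Proof. by left. Qed.

(** The component of [u] along a path is zero unless the path ends at [Triv]. There it is a multiple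
    of the empty diagram, and the functor detects the scalar. *)
Lemma semh_inj_from0 n (u : DH 0 n) : semh u = 0 -> u = 0.
Proof.
move=> u0; rewrite -[u]ccomp1l basis_complete ccomp_suml.
have H p : List.In p (basis R n) -> ld p ** u = 0.
  move=> Hp; have [a] := diag_all u In_Triv Hp; rewrite ccomp1r => E.
  have [e|H0] := vhomP R Triv (lv p); last by rewrite E H0 scaler0.
  have : semh (ld p ** u) = 0 by rewrite semh_comp u0 comp_lfun0r.
  move: E; case: p e {Hp} => v l d /= e; case: _ / e l d => _ d E; rewrite E.
  rewrite semhZ semh1 => /eqP; rewrite scaler_eq0 (negPf (lone_neq0 _)) orbF.
  by move/eqP=> ->; rewrite scale0r.
elim: (basis R n) H => [_|p s IH H]; first by rewrite big_nil.
rewrite big_cons -ccompA H ?ccomp0r ?add0r; last by left.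
by apply: IH => q Hq; apply: H; right.
Qed.

(** Bending the last input strand upwards lowers [m]; the zigzag relation recovers [u] from its bent
    version. *)
Lemma semh_inj m n (u : DH m n) : semh u = 0 -> u = 0.
Proof.
elim: m n u => [|m IH] n u u0; first exact: semh_inj_from0.
have E : strand u ** cup R m = 0.
  by apply: IH; rewrite semh_comp semh_strand u0 strandV0 comp_lfun0l.
rewrite -[u]ccomp1r -(zigzagr R m) ccompA -cap_natural -ccompA -strand_comp.
by rewrite E strand0 ccomp0r.
Qed.

(** The map is split along paths; each component is lifted at its end vertex and carried back by
    [lu p]. *)
Lemma semh_surj_from0 n (f : 'Hom(tpow 0, tpow n)) :
  irrational (theta / pi) -> f \in GHom 0 n -> exists u : DH 0 n, semh u = f.
Proof.
move=> theta_irr fG; have -> : f = (semh (dia_id R DiTL n) \o f)%VF.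
  by rewrite semh1 comp_lfun1l.
rewrite basis_complete semh_suml.
have H p : List.In p (basis R n) ->
    exists u : DH 0 n, semh u = (semh (lu p ** ld p) \o f)%VF.
  move=> Hp.
  have [||x Ex] := @invariant_scal R theta (lv p)
    (semh (vproj R (lv p) ** ld p) \o f)%VF theta_irr.
  - by apply: equivariant_compV fG; exact: semh_equivariant.
  - by rewrite comp_lfunA -semh_comp ccompA vproj_idem.
  exists (lu p ** x); rewrite semh_comp Ex comp_lfunA -semh_comp ccompA.
  by rewrite basis_absorb.
elim: (basis R n) H => [_|p s IH H].
  by exists 0; rewrite big_nil comp_lfun0l semh0.
have [x Ex] := IH (fun q Hq => H q (or_intror Hq)).
have [y Ey] := H p (or_introl erefl).
by exists (y + x); rewrite big_cons comp_lfunDl semhD Ex Ey.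
Qed.

(** A strand of the linear map is bent, the result is lifted by induction, and the strand of the
    lifted diagram is bent back. *)
Lemma semh_surj m n (f : 'Hom(tpow m, tpow n)) :
  irrational (theta / pi) -> f \in GHom m n -> exists u : DH m n, semh u = f.
Proof.
move=> theta_irr; elim: m n f => [|m IH] n f fG; first exact: semh_surj_from0.
have [|u Eu] := IH n.+1 (strandV f \o semh (cup R m))%VF.
  apply: equivariant_compV; first exact: strandV_equivariant.
  exact: semh_equivariant.
exists (cap R n ** strand u).
rewrite semh_comp semh_strand Eu strandV_comp comp_lfunA cap_strandV.
by rewrite -comp_lfunA -semh_strand -semh_comp zigzagr semh1 comp_lfun1r.
Qed.

End FullyFaithful.

Theorem theorem4p1p4 (R : realType) (theta : R)
    (theta_irr : irrational (theta / pi)) :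
  fully_faithful (DiTL_functor theta).
Proof.
move=> m n.
have surj (f : intertwiner (Vpow theta m) (Vpow theta n)) :
    exists u, F_mor theta u = f.
  have [u Eu] := semh_surj theta_irr (ihomP f).
  by exists u; apply: val_inj; exact: Eu.
(* Preimages are picked by choice, so one inverse law is immediate and injectivity yields the
   other. *)
pose inv f := projT1 (cid (surj f)).
have invK f : F_mor theta (inv f) = f by exact: projT2 (cid (surj f)).
exists inv => [u|f]; last exact: invK.
have E : semh (inv (F_mor theta u)) = semh u := congr1 (@ihom _ _ _ _) (invK _).
apply/eqP; rewrite -subr_eq0; apply/eqP; apply: semh_inj.
by rewrite semhB E subrr.
Qed.
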